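(* Let $d\ge 2$. There is a constant $C_d>0$, depending only on $d$, such that the following holds. Let $A\subseteq\mathbb{R}^d$ be a measurable set with upper density equal to $\epsilon>0$, and let $K\subseteq\mathbb{R}^d$ be a $0$-symmetric convex body which affords a $C_d\epsilon$-good probability measure on its boundary, i.e. there is a $C_d\epsilon$-good probability measure supported on $\partial K$. Then there is $t_0>0$ such that $t\in D_K(A)$ for all real $t\ge t_0$.
   Context: A $0$-symmetric convex body $K\subseteq\mathbb{R}^d$ (i.e. $K=-K$) defines the norm $\|x\|_K=\sup\{t\ge 0: x\notin tK\}$ on $\mathbb{R}^d$ (with $\sup\emptyset=0$). For $A\subseteq\mathbb{R}^d$ the $K$-distance set is $D_K(A)=\{\|x-y\|_K: x,y\in A\}$. Upper density: a measurable set $A$ has upper density $\limsup_{\ell\to\infty}\ \sup_Q |A\cap Q|/|Q|$, where $Q$ ranges over cubes of side $\ell$ and $|\cdot|$ is Lebesgue measure. Thus $A$ has positive upper density if and only if there is $\rho>0$ such that there are arbitrarily large cubes $Q$ with $|A\cap Q|\ge\rho|Q|$. The Fourier transform of a finite measure $\mu$ on $\mathbb{R}^d$ is $\widehat{\mu}(\xi)=\int_{\mathbb{R}^d}e^{-2\pi i\langle x,\xi\rangle}\,d\mu(x)$. For $\eta>0$, a finite measure $\mu$ on $\mathbb{R}^d$ is called $\eta$-good if for some $R>0$ we have $|\widehat{\mu}(x)|\le\eta$ whenever $|x|\ge R$ (Euclidean norm). *)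

(* Defs.v *)
From mathcomp Require Import all_boot all_order all_algebra.
From mathcomp Require Import all_classical all_reals all_analysis.
From mathcomp Require Import complex.

Set Implicit Arguments.
Unset Strict Implicit.
Unset Printing Implicit Defensive.

Import Order.TTheory GRing.Theory Num.Theory.
Import numFieldNormedType.Exports.

Local Open Scope classical_set_scope.
Local Open Scope ring_scope.
Local Open Scope complex_scope.

Section euclidean_space.
Context {R : realType} {d : nat}.
Implicit Types (x y : 'rV[R]_d) (A K : set 'rV[R]_d).

Definition dot x y : R := \sum_(i < d) x 0 i * y 0 i.

(* The library norm `|x| on 'rV[R]_d is the sup norm. *)
Definition euclidean_norm x : R := Num.sqrt (dot x x).

Definition box (a b : 'rV[R]_d) : set 'rV[R]_d :=
  [set x | forall i, a 0 i < x 0 i <= b 0 i].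

Definition box_volume (a b : 'rV[R]_d) : R :=
  \prod_(i < d) Num.max 0 (b 0 i - a 0 i).

(* Lebesgue outer measure; on the sets satisfying [lebesgue_measurable] it is
   the (complete) d-dimensional Lebesgue measure. *)
Definition lebesgue_outer A : \bar R :=
  ereal_inf [set (\sum_(k <oo) (box_volume (I k).1 (I k).2)%:E)%E |
    I in [set I : nat -> 'rV[R]_d * 'rV[R]_d |
           A `<=` \bigcup_k box (I k).1 (I k).2]].

Definition lebesgue_measurable A : Prop := lebesgue_outer.-caratheodory A.

(* Axis-parallel cubes with lower corner [a] and side [l]. *)
Definition cube (a : 'rV[R]_d) (l : R) : set 'rV[R]_d :=
  [set x | forall i, a 0 i <= x 0 i <= a 0 i + l].

Definition upper_density A : \bar R :=
  limf_esup (fun l : R =>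
    ereal_sup [set (lebesgue_outer (A `&` cube a l)
                    / lebesgue_outer (cube a l))%E | a in [set: 'rV[R]_d]])
  (pinfty_nbhs R).

Definition symmetric_convex_body K : Prop :=
  [/\ convex_set (K : set (convex_lmodType 'rV[R]_d)),
      compact K, interior K !=set0 & [set - x | x in K] = K].

(* [sup set0 = 0], which gives the value 0 at the origin. *)
Definition body_norm K x : R :=
  sup [set t | 0 <= t /\ ~ [set t *: y | y in K] x].

Definition distance_set K A : set R :=
  [set body_norm K (x - y) | x in A & y in A].

Definition boundary K : set 'rV[R]_d := closure K `\` interior K.

End euclidean_space.

(* The topology of the sup norm is the usual one, so this is R^d with its usual
   Borel sigma-algebra. *)
Definition borel (R : realType) (d : nat) :=
  g_sigma_algebraType (@open 'rV[R]_d).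

Definition expi {R : realType} (theta : R) : R[i] := cos theta +i* sin theta.

Definition complex_integral {R : realType} {disp : measure_display}
    {T : measurableType disp} (mu : {measure set T -> \bar R}) (f : T -> R[i]) : R[i] :=
  (\int[mu]_x complex.Re (f x)) +i* (\int[mu]_x complex.Im (f x)).

Definition fourier {R : realType} {d : nat}
    (mu : {finite_measure set (borel R d) -> \bar R}) (xi : 'rV[R]_d) : R[i] :=
  complex_integral mu (fun x : 'rV[R]_d => expi (- (2 * pi * dot x xi))).

Definition eta_good {R : realType} {d : nat} (eta : R)
    (mu : {finite_measure set (borel R d) -> \bar R}) : Prop :=
  exists2 r : R, 0 < r &
    forall xi : 'rV[R]_d, r <= euclidean_norm xi -> `|fourier mu xi| <= eta%:C.

(* Main.v *)
Require Import Defs.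
From mathcomp Require Import all_boot all_order all_algebra.
From mathcomp Require Import all_classical all_reals all_analysis.
From mathcomp Require Import measurable_realfun complex ring lra zify.

Import Order.TTheory GRing.Theory Num.Theory.
Import numFieldNormedType.Exports.

Local Open Scope classical_set_scope.
Local Open Scope ring_scope.

(** If the conclusion fails, there are arbitrarily many, arbitrarily lacunary
    [t_1 < ... < t_J] that are not [K]-distances of [A].  In a large cube where
    [A] has density about [eps], cut into small cells, a fixed proportion of
    density about [eps] consists of cells almost filled by [A]; two such cells
    whose offset is close to [t_j y] with [y] in the boundary of [K] would
    contain two points of [A] at distance [t_j].  Take for [P] the points of a
    very fine grid lying in one corner of the filled cells, place [P] on a
    torus twice as large as the cube, and let [Phi] be a power of
    [prod_i (1 + cos w_i) / 2], a nonnegative trigonometric polynomial with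
    nonnegative coefficients that is concentrated near [0].  Then
    [sum_(p, q in P) Phi (t_j y - (p - q))] is negligible.  Integrated over
    [y], it equals [sum_k c_k |P^(k)|^2 mu^(t_j k / L)].  There the frequency
    [0] contributes about [eps] times the total mass, low frequencies
    contribute nonnegatively, high frequencies contribute at least [- C eps]
    times the total mass, and the ranges of intermediate frequencies for
    different [j] are disjoint, so for some [j] their contribution is small.
    Everything is a finite sum, so no Plancherel theorem is needed. *)

(** * Trigonometric polynomials *)

Section DotProduct.
Context {R : realType} {d : nat}.
Implicit Types (x y z : 'rV[R]_d).

Lemma dotDl x y z : dot (x + y) z = dot x z + dot y z.
Proof. by rewrite -big_split; apply: eq_bigr => i _; rewrite !mxE mulrDl. Qed.

Lemma dotDr x y z : dot x (y + z) = dot x y + dot x z.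
Proof. by rewrite -big_split; apply: eq_bigr => i _; rewrite !mxE mulrDr. Qed.

Lemma dotNl x y : dot (- x) y = - dot x y.
Proof. by rewrite -sumrN; apply: eq_bigr => i _; rewrite !mxE mulNr. Qed.

Lemma dotBl x y z : dot (x - y) z = dot x z - dot y z.
Proof. by rewrite dotDl dotNl. Qed.

Lemma dotNr x y : dot x (- y) = - dot x y.
Proof. by rewrite -sumrN; apply: eq_bigr => i _; rewrite !mxE mulrN. Qed.

Lemma dotBr x y z : dot x (y - z) = dot x y - dot x z.
Proof. by rewrite dotDr dotNr. Qed.

Lemma dotZl a x y : dot (a *: x) y = a * dot x y.
Proof. by rewrite mulr_sumr; apply: eq_bigr => i _; rewrite !mxE mulrA. Qed.

Lemma dotZr a x y : dot x (a *: y) = a * dot x y.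
Proof. by rewrite mulr_sumr; apply: eq_bigr => i _; rewrite !mxE mulrCA. Qed.

Lemma dot0r x : dot x 0 = 0.
Proof. by apply: big1 => i _; rewrite mxE mulr0. Qed.

Lemma dot_delta x i : dot x (delta_mx 0 i) = x 0 i.
Proof.
rewrite /dot (bigD1 i) //= big1 => [|j ji].
  by rewrite mxE !eqxx mulr1 addr0.
by rewrite mxE (negbTE ji) andbF mulr0.
Qed.

End DotProduct.

Section Trigonometry.
Context {R : realType}.
Implicit Types x y : R.

Lemma cosM x y : cos x * cos y = (cos (x + y) + cos (x - y)) / 2.
Proof. by rewrite cosD cosB; field. Qed.

Lemma cosBint x (k : int) : cos (x - k%:~R * (2 * pi)) = cos x.
Proof.
have cosn (n : nat) y : cos (y + n%:R * (2 * pi)) = cos y.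
  elim: n => [|n IH]; first by rewrite mul0r addr0.
  by rewrite -[RHS]IH -natr1 mulrDl mul1r addrA (mulr_natl pi 2) cosD2pi.
case: k => n; last first.
  by rewrite NegzE mulrNz mulNr opprK cosn.
by rewrite -[RHS](cosn n) -{2}[x](subrK (n%:R * (2 * pi))) -addrA addrA cosn.
Qed.

Lemma cos_lt1 x : 0 < `|x| < 2 * pi -> cos x < 1.
Proof.
move=> /andP[x0 x2]; rewrite -cos_norm; set y := `|x| in x0 x2 *.
have -> : y = (y / 2) *+ 2 by rewrite -mulr_natr divfK.
rewrite cos_mulr2n cos2sin2.
have s0 : 0 < sin (y / 2) by apply: sin_gt0_pi; apply/andP; split; lra.
have : 0 < sin (y / 2) ^+ 2 by rewrite exprn_gt0.
set u := sin _ ^+ 2; rewrite -mulr_natr; lra.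
Qed.

(** Cosine decreases on [[0, pi]], and a value of [|y|] beyond [pi] is first reflected to
    [2 pi - |y|]. The upper bound on [|y|] keeps it away from the next period, where points of a
    torus would alias. *)
Lemma cos_le_away x y : 0 <= x <= pi -> x <= `|y| <= 2 * pi - x -> cos y <= cos x.
Proof.
move=> /andP[x0 xp] /andP[xy yx]; rewrite -(cos_norm y); set z := `|y| in xy yx *.
have [zp|zp] := leP z pi.
  rewrite leNgt ltr_cos ?in_itv/= ?x0 ?xp -?leNgt//; lra.
rewrite -(cosBint z 1) -cosN opprB mul1r.
rewrite leNgt ltr_cos ?in_itv/= -?leNgt; lra.
Qed.

End Trigonometry.

Section TrigonometricPolynomials.
Context {R : realType} {d : nat}.
Implicit Types (w : 'rV[R]_d) (k : 'rV[int]_d).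

Definition freq k : 'rV[R]_d := map_mx intr k.

Lemma freqD k k' : freq (k + k') = freq k + freq k'.
Proof. by apply/rowP => i; rewrite !mxE intrD. Qed.

Lemma freqB k k' : freq (k - k') = freq k - freq k'.
Proof. by apply/rowP => i; rewrite !mxE intrB. Qed.

Lemma freq_delta i : freq (delta_mx 0 i) = delta_mx 0 i.
Proof. by apply/rowP => j; rewrite !mxE; case: (_ && _). Qed.

(** Each factor is [cos (w_i / 2) ^ 2] to the power [M]: a nonnegative kernel of degree [M] in each
    coordinate, peaked at [0] modulo [2 pi]. *)
Definition bump (M : nat) w : R := \prod_(i < d) ((1 + cos (w 0 i)) / 2) ^+ M.

(** Multiplying [cos (w . k)] by [cos w_j] splits [k] into [k + e_j] and [k - e_j] with equal
    weights, so induction keeps the weights nonnegative and raises the degree in coordinate [j] by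
    at most one. The list [s] may repeat a frequency. *)
Lemma prod_cos_expansion (r : seq 'I_d) : exists s : seq (R * 'rV[int]_d),
  (forall e, e \in s ->
     0 <= e.1 /\ forall i, `|e.2 0 i| <= (count_mem i r)%:Z) /\
  forall w, \prod_(i <- r) ((1 + cos (w 0 i)) / 2) =
            \sum_(e <- s) e.1 * cos (dot w (freq e.2)).
Proof.
elim: r => [|j r [s [s_ge0 sE]]].
  exists [:: (1, 0)]; split => [e|w].
    by rewrite inE => /eqP ->; split=> // i; rewrite mxE normr0.
  rewrite big_nil big_seq1 /= mul1r.
  have -> : freq 0 = 0 by apply/rowP => i; rewrite !mxE.
  by rewrite dot0r cos0.
pose f (e : R * 'rV[int]_d) := [:: (e.1 / 2, e.2);
  (e.1 / 4, e.2 + delta_mx 0 j); (e.1 / 4, e.2 - delta_mx 0 j)].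
exists (flatten [seq f e | e <- s]); split => [e|w].
  move=> /flatten_mapP[a /s_ge0[a0 ak]].
  have bnd i (b : bool) (z : int) : `|z| <= ((b && (j == i)) : nat)%:Z ->
      `|a.2 0 i + z| <= (count_mem i (j :: r))%:Z.
    move=> bz; apply: le_trans (ler_normD _ _) _; rewrite /= addnC PoszD lerD//.
    by apply: le_trans bz _; case: b (j == i) => [] [].
  rewrite !inE => /or3P[] /eqP -> /=; split; rewrite ?divr_ge0// => i.
  - by have := bnd i false 0; rewrite addr0; apply.
  - rewrite !mxE; apply: (bnd i true); rewrite eqxx/= [i == j]eq_sym.
    by case: (j == i).
  - rewrite !mxE; apply: (bnd i true); rewrite eqxx/= [i == j]eq_sym normrN.
    by case: (j == i).
rewrite big_cons sE mulr_sumr big_flatten/= big_map; apply: eq_bigr => e _.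
rewrite !big_cons big_nil /= freqD freqB freq_delta dotDr dotBr dot_delta.
by rewrite cosD cosB; field.
Qed.

Lemma bump_expansion M : exists s : seq (R * 'rV[int]_d),
  (forall e, e \in s -> 0 <= e.1 /\ forall i, `|e.2 0 i| <= M%:Z) /\
  forall w, bump M w = \sum_(e <- s) e.1 * cos (dot w (freq e.2)).
Proof.
pose r := flatten (nseq M (index_enum 'I_d)).
have [s [s_ge0 sE]] := prod_cos_expansion r; exists s; split.
  move=> e /s_ge0[e0 ek]; split=> // i; apply: le_trans (ek i) _.
  rewrite lez_nat /r; elim: M {r s s_ge0 sE e e0 ek} => //= n IH.
  rewrite count_cat -add1n leq_add// count_uniq_mem ?index_enum_uniq//.
  exact: leq_b1.
move=> w; rewrite -sE /r /bump prodrXl.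
elim: M {r s s_ge0 sE} => [|n IH]; first by rewrite expr0 big_nil.
by rewrite exprS IH/= big_cat.
Qed.

Lemma bump_ge0 M w : 0 <= bump M w.
Proof.
apply: prodr_ge0 => i _; by rewrite exprn_ge0// divr_ge0.
Qed.

Lemma bump_le M w (rho : R) i :
  (1 + cos (w 0 i)) / 2 <= rho -> bump M w <= rho ^+ M.
Proof.
have c0 j : 0 <= (1 + cos (w 0 j)) / 2 by have := cos_geN1 (w 0 j); lra.
move=> wi; rewrite /bump (bigD1 i)//= -[leRHS]mulr1 ler_pM ?exprn_ge0//.
- by apply: prodr_ge0 => j _; rewrite exprn_ge0.
- by rewrite lerXn2r// nnegrE// (le_trans (c0 i)).
rewrite prodr_ile1// => j _; rewrite exprn_ge0//=; apply: exprn_ile1 => //.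
by have := cos_le1 (w 0 j); lra.
Qed.

Lemma bump0 M : bump M 0 = 1.
Proof.
by apply: big1 => i _; rewrite mxE cos0 -(natrD _ 1 1) divff// expr1n.
Qed.

Definition gridpt (N : nat) (n : {ffun 'I_d -> 'I_N}) : 'rV[R]_d :=
  \row_i (2 * pi / N%:R * (n i)%:R).

(* The sum over the grid is invariant under a shift of one coordinate, which
   changes the phase [a] by some [phi] with [cos phi <> 1]; adding the identities
   for [phi] and [- phi] gives [2 S(a) = 2 cos phi S(a)]. *)
Lemma sum_grid_cos_eq0 N k (a : R) : k != 0 -> (forall i, `|k 0 i| < N%:Z) ->
  \sum_(n : {ffun 'I_d -> 'I_N}) cos (a + dot (gridpt N n) (freq k)) = 0.
Proof.
move=> k0 kN.
have [i ki] : exists i, k 0 i != 0.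
  apply/existsP; apply: contraNT k0; rewrite negb_exists => /forallP k0.
  by apply/eqP/rowP => i; rewrite mxE; apply/eqP; have := k0 i; rewrite negbK.
have Ngt0 : (0 < N)%N by have := kN i; lia.
have N0 : (0 : R) < N%:R by rewrite ltr0n.
pose S (b : R) := \sum_(n : {ffun 'I_d -> 'I_N}) cos (b + dot (gridpt N n) (freq k)).
pose phi : R := 2 * pi * (k 0 i)%:~R / N%:R.
have Sphi b : S (b + phi) = S b.
  pose sh (n : {ffun 'I_d -> 'I_N}) : {ffun 'I_d -> 'I_N} :=
    [ffun j => if j == i then ordS (n j) else n j].
  have shi : injective sh.
    move=> n n' /ffunP nn'; apply/ffunP => j; have := nn' j; rewrite !ffunE.
    by case: ifP => // _ /(bij_inj (ordS_bij _)).
  rewrite /S [RHS](reindex_inj shi); apply: eq_bigr => n _.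
  have [e He] : exists e : int, dot (gridpt N (sh n)) (freq k) =
      phi + dot (gridpt N n) (freq k) - e%:~R * (2 * pi).
    (* A coordinate wrapping from [N - 1] to [0] loses [N] grid steps, which is [k 0 i] full turns
       of the phase. *)
    pose e : int := if ((n i).+1 == N) then k 0 i else 0; exists e.
    rewrite /dot (bigD1 i)//= [X in _ + X - _](bigD1 i)//=.
    under eq_bigr => j ji do rewrite !mxE ffunE (negbTE ji).
    under [X in _ + (_ + X) - _]eq_bigr => j ji do rewrite !mxE.
    rewrite !mxE ffunE eqxx /= /phi /e; case: eqP => [nN|/eqP nN].
      rewrite nN modnn.
      have /(congr1 (fun m => m%:R : R)) := nN.
      rewrite -natr1 => /(canRL (addrK _)) ->.
      by field; rewrite gt_eqF.
    rewrite modn_small; last by rewrite ltn_neqAle nN ltn_ord.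
    by rewrite mulr0z mul0r subr0 -[(n i).+1%:R]natr1; field; rewrite gt_eqF.
  by rewrite He -[LHS](cosBint _ e); congr cos; ring.
have cphi : cos phi < 1.
  apply: cos_lt1; rewrite /phi !normrM normfV (ger0_norm (pi_ge0 _)).
  rewrite [`|N%:R|]ger0_norm ?ltW// [`|2|]ger0_norm//.
  have p0 := pi_gt0 R.
  have k1 : (0 : R) < `|(k 0 i)%:~R| by rewrite normr_gt0 intr_eq0.
  have k2 : `|(k 0 i)%:~R| < N%:R :> R.
    by rewrite -intr_norm pmulrn ltr_int.
  by rewrite !mulr_gt0 ?invr_gt0//= ltr_pdivrMr// ltr_pM2l ?mulr_gt0.
have : 2 * S a = 2 * cos phi * S a.
  have -> : 2 * S a = S (a + phi) + S (a - phi).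
    by rewrite Sphi -(Sphi (a - phi)) subrK mulr_natl mulr2n.
  rewrite /S -big_split mulr_sumr; apply: eq_bigr => n _ /=.
  rewrite -mulrA cosM [phi + _]addrC -(cosN (phi - _)) opprB.
  rewrite (addrAC a phi) (addrAC a (- phi)).
  by rewrite mulrC divfK.
move/eqP; rewrite -subr_eq0 -mulrBl mulf_eq0 => /orP[/eqP|/eqP//].
by move: cphi; lra.
Qed.

End TrigonometricPolynomials.

(** * Pair correlations of sets of grid points *)

Section Correlation.
Context {R : realType} {d : nat}.
Implicit Types (z xi : 'rV[R]_d).

(** The squared modulus of the exponential sum of [P] at [xi], split into real and imaginary
    parts. *)
Definition energy {T : finType} (x : T -> 'rV[R]_d) (P : {set T}) xi : R :=
  (\sum_(p in P) cos (dot (x p) xi)) ^+ 2 + (\sum_(p in P) sin (dot (x p) xi)) ^+ 2.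

Lemma energy_ge0 (T : finType) (x : T -> 'rV[R]_d) P xi : 0 <= energy x P xi.
Proof. by rewrite addr_ge0 ?sqr_ge0. Qed.

Lemma energy0 (T : finType) (x : T -> 'rV[R]_d) P : energy x P 0 = #|P|%:R ^+ 2.
Proof.
rewrite /energy; under eq_bigr do rewrite dot0r cos0.
by under [in X in _ + X]eq_bigr do rewrite dot0r sin0; rewrite !sumr_const mul0rn expr0n/= addr0.
Qed.

(** After the addition formulas, the factor of [sin (dot z xi)] is antisymmetric in [p] and [q] and
    cancels in the double sum. *)
Lemma energyE (T : finType) (x : T -> 'rV[R]_d) (P : {set T}) z xi :
  \sum_(p in P) \sum_(q in P) cos (dot (z - (x p - x q)) xi) =
  energy x P xi * cos (dot z xi).
Proof.
pose c p := cos (dot (x p) xi); pose s p := sin (dot (x p) xi).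
transitivity (\sum_(p in P) \sum_(q in P)
   (cos (dot z xi) * (c p * c q + s p * s q)
    + sin (dot z xi) * (s p * c q - c p * s q))).
  apply: eq_bigr => p _; apply: eq_bigr => q _.
  by rewrite dotBl dotBl cosB [cos (_ - _)]cosB [sin (_ - _)]sinB.
transitivity (\sum_(p in P) (cos (dot z xi) *
    (c p * (\sum_(q in P) c q) + s p * (\sum_(q in P) s q))
    + sin (dot z xi) * (s p * (\sum_(q in P) c q) - c p * (\sum_(q in P) s q)))).
  apply: eq_bigr => p _.
  by rewrite big_split/= -!mulr_sumr big_split/= sumrB -!mulr_sumr.
rewrite big_split/= -!mulr_sumr big_split/= sumrB -!mulr_suml /energy.
by rewrite -/c -/s; ring.
Qed.

(** The frequencies of the bump diagonalise the pair correlation. The total mass is its value at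
    [z = 0], where for each [q] the sum over [P] is at most the sum over the whole grid. *)
Lemma bump_correlation (N : nat) : (0 < N)%N ->
  exists s : seq (R * 'rV[int]_d), exists2 phi0 : R,
  [/\ 1 <= phi0 * N%:R ^+ d, (forall e, e \in s -> 0 <= e.1) &
      phi0 = \sum_(e <- s | e.2 == 0) e.1] &
  forall P : {set {ffun 'I_d -> 'I_N}},
   \sum_(e <- s) e.1 * energy (gridpt N) P (freq e.2) <= #|P|%:R * (phi0 * N%:R ^+ d) /\
   forall z, \sum_(p in P) \sum_(q in P) bump N.-1 (z - (gridpt N p - gridpt N q)) =
     \sum_(e <- s) e.1 * energy (gridpt N) P (freq e.2) * cos (dot z (freq e.2)).
Proof.
move=> N0; have [s [s0 sE]] := @bump_expansion R d N.-1.
pose phi0 : R := \sum_(e <- s | e.2 == 0) e.1.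
(* Exact quadrature: the degree [N - 1] is below the number [N] of grid points per coordinate, so
   only the frequency [0] survives. *)
have quad x : \sum_(n : {ffun 'I_d -> 'I_N}) bump N.-1 (x - gridpt N n) =
    phi0 * N%:R ^+ d.
  under eq_bigr do rewrite sE; rewrite exchange_big/=.
  rewrite (bigID (fun e => e.2 == 0))/= [X in _ + X](_ : _ = 0) ?addr0; last first.
    rewrite big_seq_cond; apply: big1 => e /andP[/s0[_ ek] e0]; rewrite -mulr_sumr.
    rewrite -[RHS](mulr0 e.1); congr (_ * _).
    apply: etrans (@sum_grid_cos_eq0 R d N (- e.2) (dot x (freq e.2)) _ _).
    - apply: eq_bigr => n _; rewrite dotBl -dotNr; congr (cos (_ + dot _ _)).
      by apply/rowP => i; rewrite !mxE intrN.
    - by rewrite oppr_eq0.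
    - by move=> i; rewrite mxE normrN (le_lt_trans (ek i))// ltz_nat prednK.
  rewrite /phi0 mulr_suml; apply: eq_bigr => e /eqP ->.
  rewrite -mulr_sumr; congr (_ * _).
  under eq_bigr => n _.
    have -> : freq 0 = 0 :> 'rV[R]_d by apply/rowP => i; rewrite !mxE.
    rewrite dot0r cos0; over.
  by rewrite sumr_const card_ffun !card_ord natrX.
exists s, phi0; first split => //.
(* Centred at a grid point, the quadrature sum contains the term [bump 0 = 1]. *)
- pose n0 : {ffun 'I_d -> 'I_N} := [ffun=> Ordinal N0].
  rewrite -(quad (gridpt N n0)) (bigD1 n0)//= subrr bump0 lerDl.
  by apply: sumr_ge0 => n _; exact: bump_ge0.
- by move=> e /s0[].
move=> P.
have corr z : \sum_(p in P) \sum_(q in P) bump N.-1 (z - (gridpt N p - gridpt N q)) =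
     \sum_(e <- s) e.1 * energy (gridpt N) P (freq e.2) * cos (dot z (freq e.2)).
  under [RHS]eq_bigr do rewrite -mulrA -energyE mulr_sumr.
  rewrite [RHS]exchange_big/=; apply: eq_bigr => p _.
  under [RHS]eq_bigr do rewrite mulr_sumr.
  by rewrite [RHS]exchange_big/=; apply: eq_bigr => q _; rewrite sE.
split => //.
have -> : \sum_(e <- s) e.1 * energy (gridpt N) P (freq e.2) =
     \sum_(e <- s) e.1 * energy (gridpt N) P (freq e.2) * cos (dot 0 (freq e.2)).
  apply: eq_bigr => e _; have -> : dot 0 (freq e.2) = 0 :> R.
    by apply: big1 => i _; rewrite mxE mul0r.
  by rewrite cos0 mulr1.
rewrite -corr exchange_big /= mulr_natl -sumr_const; apply: ler_sum => q _.
rewrite -(quad (gridpt N q)) [leRHS](bigID (mem P))/= -[leLHS]addr0 lerD//.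
  by apply: ler_sum => p _; rewrite sub0r opprB.
by apply: sumr_ge0 => n _; exact: bump_ge0.
Qed.

(* Summed over [j], the resonant terms cost the total mass at most once, while
   the frequency [0] is counted for every [j]. *)
Lemma lacunary_pigeonhole (T : finType) (s : seq (R * 'rV[int]_d)) (W : 'rV[int]_d -> R)
    (m : T -> 'rV[int]_d -> R) (mid : T -> 'rV[int]_d -> bool) (eta tiny G0 : R) :
  0 <= eta -> (forall e, e \in s -> 0 <= e.1) -> (forall k, 0 <= W k) ->
  (forall j, m j 0 = 1) ->
  (forall j k, - eta - (mid j k)%:R <= m j k) ->
  (forall i j k, mid i k -> mid j k -> i = j) ->
  (forall j, \sum_(e <- s) e.1 * W e.2 * m j e.2 <= tiny) ->
  \sum_(e <- s) e.1 * W e.2 <= G0 ->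
  #|T|%:R * ((\sum_(e <- s | e.2 == 0) e.1) * W 0 - tiny) <= (eta * #|T|%:R + 1) * G0.
Proof.
move=> eta0 s0 W0 m1 mge midI mtiny sG0.
set phi0 := \sum_(e <- s | _) _.
have G00 : 0 <= G0.
  apply: le_trans sG0; rewrite big_seq; apply: sumr_ge0 => e /s0 e0.
  by rewrite mulr_ge0.
(* Adding [eta + mid] to [m j] makes every coefficient nonnegative, so the entries of nonzero
   frequency can be discarded. *)
have H j : phi0 * W 0 - tiny <= \sum_(e <- s) e.1 * W e.2 * (eta + (mid j e.2)%:R).
  rewrite lerBlDr; apply: le_trans (lerD (lexx _) (mtiny j)).
  rewrite -big_split/= /phi0 mulr_suml big_mkcond/= big_seq [leRHS]big_seq.
  apply: ler_sum => e /s0 e0; rewrite -mulrDr.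
  have eW : 0 <= e.1 * W e.2 by rewrite mulr_ge0.
  case: eqP => [->|_].
    by rewrite -[leLHS]mulr1 m1 ler_wpM2l ?mulr_ge0//; have := ler0n R (mid j 0); lra.
  by rewrite mulr_ge0//; have := mge j e.2; lra.
rewrite mulr_natl -sumr_const.
apply: le_trans (ler_sum _ (fun j _ => H j)) _ => /=.
rewrite exchange_big/=.
apply: (@le_trans _ _ (\sum_(e <- s) e.1 * W e.2 * (eta * #|T|%:R + 1))); last first.
  by rewrite -mulr_suml mulrC ler_wpM2l// addr_ge0// mulr_ge0.
rewrite big_seq [leRHS]big_seq; apply: ler_sum => e /s0 e0.
rewrite -mulr_sumr ler_wpM2l ?mulr_ge0// big_split/= sumr_const mulr_natr lerD2l.
have [j jm|nomid] := pickP (fun j => mid j e.2).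
  rewrite (bigD1 j)//= jm big1 ?addr0// => i ij.
  case E: (mid i e.2) => //; have /eqP := midI _ _ _ E jm; by rewrite (negbTE ij).
by rewrite big1// => j _; rewrite nomid.
Qed.

End Correlation.

(** * Lebesgue outer measure *)

Section BoxVolume.
Context {R : realType}.
Implicit Types (I : R * R) (r : R).

Definition itv_len I : R := Num.max 0 (I.2 - I.1).
Definition itv_ind I (x : R) : R := (I.1 < x <= I.2)%R%:R.

Lemma len_ge0 I : 0 <= itv_len I.
Proof. by rewrite le_max lexx. Qed.

Lemma indE I : itv_ind I = \1_(`]I.1, I.2]%classic : set R).
Proof. by apply/funext => x; rewrite /itv_ind indicE mem_setE in_itv. Qed.

Lemma measurable_ind I : measurable_fun [set: R] (itv_ind I).
Proof. by rewrite indE; exact: measurable_indic. Qed.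

Lemma integral_ind r I : 0 <= r ->
  (\int[lebesgue_measure]_x (r * itv_ind I x)%:E = (r * itv_len I)%:E)%E.
Proof.
move=> r0; under eq_integral do rewrite EFinM.
rewrite ge0_integralZl_EFin//; first last.
- by apply/measurable_EFinP; exact: measurable_ind.
- by move=> x _; rewrite lee_fin ler0n.
rewrite indE integral_indic// setIT EFinM; congr (_ * _)%E.
apply: etrans (lebesgue_measure_itv _) _; rewrite /= lte_fin.
rewrite /itv_len; case: ltP => h.
  by rewrite -EFinB; congr EFin; apply/esym/max_r; lra.
by congr EFin; apply/esym/max_l; lra.
Qed.

(* Integrating out one coordinate at a time replaces the compactness argument
   for the volume of a covered box. *)
Lemma indicator_cover_volume n (c : nat -> R) (b : R) (I : nat -> 'I_n -> R * R)
    (B : 'I_n -> R * R) :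
  0 <= b -> (forall k, 0 <= c k) ->
  (forall x : 'I_n -> R, ((b * \prod_i itv_ind (B i) (x i))%:E <=
     \sum_(0 <= k <oo) (c k * \prod_i itv_ind (I k i) (x i))%:E)%E) ->
  ((b * \prod_i itv_len (B i))%:E <= \sum_(0 <= k <oo) (c k * \prod_i itv_len (I k i))%:E)%E.
Proof.
elim: n c b I B => [|n IH] c b I B b0 c0 cov.
  have := cov (fun=> 0); rewrite !big_ord0.
  by under eq_eseriesr do rewrite big_ord0; under [in X in _ -> X]eq_eseriesr do rewrite big_ord0.
rewrite big_ord_recl mulrA.
under eq_eseriesr do rewrite big_ord_recl mulrA.
apply: IH => [|k|x]; rewrite ?mulr_ge0 ?len_ge0//.
have ind0 (J : 'I_n -> R * R) : 0 <= \prod_i itv_ind (J i) (x i).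
  by apply: prodr_ge0 => i _; rewrite ler0n.
(* With the coordinates [x] frozen, each first side length becomes an integral over [y]; the series
   moves inside, and what remains is the hypothesis at the point [(y, x)]. *)
rewrite mulrAC -integral_ind ?mulr_ge0//.
under eq_eseriesr => k _ do rewrite mulrAC -integral_ind ?mulr_ge0//.
rewrite -integral_nneseries//; first last.
- by move=> k y _; rewrite lee_fin !mulr_ge0 ?ler0n.
- move=> k; apply/measurable_EFinP; apply: measurable_funM => //.
  exact: measurable_ind.
apply: ge0_le_integral => //.
- by move=> y _; rewrite lee_fin !mulr_ge0 ?ler0n.
- by apply/measurable_EFinP; apply: measurable_funM => //; exact: measurable_ind.
- apply: ge0_emeasurable_sum => //.
  + by move=> k y _ _; rewrite lee_fin !mulr_ge0 ?ler0n.
  + move=> k _; apply/measurable_EFinP; apply: measurable_funM => //; exact: measurable_ind.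
move=> y _.
pose z (i : 'I_n.+1) := if unlift ord0 i is Some j then x j else y.
have zE (J : 'I_n.+1 -> R * R) : \prod_i itv_ind (J i) (z i) =
    itv_ind (J ord0) y * \prod_i itv_ind (J (lift ord0 i)) (x i).
  rewrite big_ord_recl /z unlift_none; congr (_ * _).
  by apply: eq_bigr => i _; rewrite liftK.
have := cov z; rewrite zE; under eq_eseriesr do rewrite zE mulrA mulrAC.
by rewrite mulrA mulrAC.
Qed.

End BoxVolume.

Section LebesgueOuter.
Context {R : realType} {d : nat}.
Implicit Types (a b x : 'rV[R]_d) (A B : set 'rV[R]_d) (I : nat -> 'rV[R]_d * 'rV[R]_d).

Lemma box_volume_ge0 a b : 0 <= box_volume a b.
Proof. by apply: prodr_ge0 => i _; exact: (len_ge0 (a 0 i, b 0 i)). Qed.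

Lemma prod_ind_in a b x : box a b x -> \prod_i itv_ind (a 0 i, b 0 i) (x 0 i) = 1.
Proof. by move=> xab; apply: big1 => i _; rewrite /itv_ind/= xab. Qed.

Lemma prod_ind_notin a b x : ~ box a b x -> \prod_i itv_ind (a 0 i, b 0 i) (x 0 i) = 0.
Proof.
move=> xab; have [i /negP/negbTE xi] : exists i, ~ (a 0 i < x 0 i <= b 0 i).
  by apply/existsNP.
by rewrite (bigD1 i)//= /itv_ind/= xi mul0r.
Qed.

Lemma lebesgue_outer_le_cover A I : A `<=` \bigcup_k box (I k).1 (I k).2 ->
  (lebesgue_outer A <= \sum_(k <oo) (box_volume (I k).1 (I k).2)%:E)%E.
Proof. by move=> AI; apply: ereal_inf_lbound; exists I. Qed.

Lemma lebesgue_outer_lt_cover A (r : \bar R) : (lebesgue_outer A < r)%E ->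
  exists2 I, A `<=` \bigcup_k box (I k).1 (I k).2 &
    (\sum_(k <oo) (box_volume (I k).1 (I k).2)%:E < r)%E.
Proof. by move=> /ereal_inf_lt[_ [I AI <-] Ir]; exists I. Qed.

Lemma le_lebesgue_outer A B : A `<=` B -> (lebesgue_outer A <= lebesgue_outer B)%E.
Proof.
move=> AB; apply: ereal_inf_le_tmp => _ [I BI <-]; exists I => //.
exact: subset_trans BI.
Qed.

Lemma lebesgue_outer_ge0 A : (0 <= lebesgue_outer A)%E.
Proof.
apply: le_ereal_inf_tmp => _ [I _ <-]; apply: nneseries_ge0 => k _ _.
by rewrite lee_fin box_volume_ge0.
Qed.

(** An instance of [indicator_cover_volume] with unit weights: a point of the box lies in some
    covering box, whose term in the series is already [1]. *)
Lemma lebesgue_outer_box_ge a b : ((box_volume a b)%:E <= lebesgue_outer (box a b))%E.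
Proof.
apply: le_ereal_inf_tmp => _ [I abI <-].
have := @indicator_cover_volume R d (fun=> 1) 1 (fun k i => ((I k).1 0 i, (I k).2 0 i))
  (fun i => (a 0 i, b 0 i)) ler01 (fun=> ler01).
rewrite mul1r; under eq_eseriesr do rewrite mul1r; apply=> x.
rewrite mul1r; under eq_eseriesr do rewrite mul1r.
pose y : 'rV[R]_d := \row_i x i.
have yE u v : \prod_i itv_ind (u 0 i, v 0 i) (x i) = \prod_i itv_ind (u 0 i, v 0 i) (y 0 i).
  by apply: eq_bigr => i _; rewrite mxE.
have ind0 k : (0 <= (\prod_i itv_ind ((I k).1 0 i, (I k).2 0 i) (x i))%:E)%E.
  by rewrite lee_fin prodr_ge0// => i _; rewrite ler0n.
have [yab|yab] := pselect (box a b y); last first.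
  by rewrite yE prod_ind_notin//; exact: nneseries_ge0.
have [k _ yk] := abI _ yab.
rewrite yE prod_ind_in// (nneseriesD1 (n := k))// -[leLHS]adde0 yE prod_ind_in//.
by rewrite leeD2l// nneseries_ge0.
Qed.

Lemma lebesgue_outer_translate A x :
  (lebesgue_outer [set y : 'rV[R]_d | A (y - x)%R] <= lebesgue_outer A)%E.
Proof.
apply: le_ereal_inf_tmp => _ [I AI <-].
rewrite (_ : (\sum_(k <oo) _)%E =
    (\sum_(k <oo) (box_volume ((I k).1 + x)%R ((I k).2 + x)%R)%:E)%E); last first.
  apply: eq_eseriesr => k _; congr EFin; apply: eq_bigr => i _.
  by rewrite !mxE; congr Num.max; ring.
apply: (@lebesgue_outer_le_cover _ (fun k => ((I k).1 + x, (I k).2 + x))).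
move=> y /AI[k _ yk]; exists k => // i; have := yk i; rewrite !mxE.
by rewrite ltrBrDr lerBlDr.
Qed.

Lemma nneseries_le (u : nat -> \bar R) (r : \bar R) : (forall k, 0 <= u k)%E ->
  (forall n, \sum_(0 <= k < n) u k <= r)%E -> (\sum_(k <oo) u k <= r)%E.
Proof.
move=> u0 ur; apply: lime_le; first exact: is_cvg_nneseries.
exact: nearW.
Qed.

Lemma lebesgue_outerU A B :
  (lebesgue_outer (A `|` B) <= lebesgue_outer A + lebesgue_outer B)%E.
Proof.
have [Ainf|Afin] := eqVneq (lebesgue_outer A) +oo%E.
  by rewrite Ainf addye ?leey// gt_eqF// (lt_le_trans _ (lebesgue_outer_ge0 B)).
have [Binf|Bfin] := eqVneq (lebesgue_outer B) +oo%E.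
  by rewrite Binf addey ?leey// gt_eqF// (lt_le_trans _ (lebesgue_outer_ge0 A)).
have lt_eps (X : set 'rV[R]_d) (e : R) : 0 < e -> lebesgue_outer X != +oo%E ->
    (lebesgue_outer X < lebesgue_outer X + e%:E)%E.
  move=> eps_gt0 Xfin; rewrite lteDl ?lte_fin// ge0_fin_numE ?lebesgue_outer_ge0//.
  by rewrite ltey.
apply/lee_addgt0Pr => e e_gt0.
have e20 : 0 < e / 2 by rewrite divr_gt0.
have [I AI sI] := lebesgue_outer_lt_cover _ _ (lt_eps _ _ e20 Afin).
have [J BJ sJ] := lebesgue_outer_lt_cover _ _ (lt_eps _ _ e20 Bfin).
(* Interleaves the two nearly optimal covers, so that the first [2 n] terms are exactly [n] terms of
   each. *)
pose K n := if odd n then J n./2 else I n./2.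
pose v (I : nat -> 'rV[R]_d * 'rV[R]_d) k := (box_volume (I k).1 (I k).2)%:E.
have v0 I' k : (0 <= v I' k)%E by rewrite lee_fin box_volume_ge0.
apply: (@le_trans _ _ (\sum_(k <oo) v K k)%E).
  apply: lebesgue_outer_le_cover => x [/AI|/BJ] [k _ xk].
    by exists k.*2 => //; rewrite /K odd_double doubleK.
  by exists k.*2.+1 => //; rewrite /K /= odd_double/= uphalf_double.
apply: (@le_trans _ _ (\sum_(k <oo) v I k + \sum_(k <oo) v J k)%E); last first.
  rewrite [e]splitr EFinD addeACA; apply: leeD; exact: ltW.
apply: nneseries_le => // n; apply: (@le_trans _ _ (\sum_(0 <= k < n.*2) v K k)%E).
  by apply: lee_sum_nneg_natr => //; rewrite -addnn leq_addr.
rewrite (_ : (\sum_(0 <= k < n.*2) v K k)%E =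
  (\sum_(0 <= k < n) v I k + \sum_(0 <= k < n) v J k)%E).
  by apply: leeD; exact: nneseries_lim_ge.
elim: n => [|n IH]; first by rewrite !big_nil adde0.
rewrite doubleS !big_nat_recr//= IH.
have -> : v K n.*2 = v I n by rewrite /v /K odd_double doubleK.
have -> : v K n.*2.+1 = v J n by rewrite /v /K/= odd_double/= uphalf_double.
by rewrite -addeA addeACA.
Qed.

Hypothesis d_gt0 : (0 < d)%N.

(** Covers are infinite sequences, so the box is padded with copies of [box 0 0]; their volume is
    [0] because [0 < d] makes the product nonempty. *)
Lemma lebesgue_outer_box_le a b : (lebesgue_outer (box a b) <= (box_volume a b)%:E)%E.
Proof.
pose I k : 'rV[R]_d * 'rV[R]_d := if k is 0%N then (a, b) else (0, 0).
apply: le_trans (@lebesgue_outer_le_cover _ I _) _; first by move=> x xab; exists 0%N.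
apply: nneseries_le => [k|n]; first by rewrite lee_fin box_volume_ge0.
case: n => [|n]; first by rewrite big_nil lee_fin box_volume_ge0.
rewrite big_nat_recl//= big1 ?adde0// => k _.
by rewrite /box_volume (bigD1 (Ordinal d_gt0))//= mxE subrr maxxx mul0r.
Qed.

Lemma lebesgue_outer_box a b : lebesgue_outer (box a b) = (box_volume a b)%:E.
Proof.
by apply/eqP; rewrite eq_le lebesgue_outer_box_le lebesgue_outer_box_ge.
Qed.

Lemma lebesgue_outer_sum_le (T : eqType) (s : seq T) (X : T -> set 'rV[R]_d) A :
  A `<=` [set x | exists2 c, c \in s & X c x] ->
  (lebesgue_outer A <= \sum_(c <- s) lebesgue_outer (A `&` X c))%E.
Proof.
elim: s A => [|c s IH] A AX.
  rewrite big_nil; have A0 : A `<=` box 0 0 by move=> x /AX[].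
  apply: le_trans (le_lebesgue_outer _ _ A0) _; rewrite lebesgue_outer_box.
  by rewrite /box_volume (bigD1 (Ordinal d_gt0))//= mxE subrr maxxx mul0r.
rewrite big_cons -{1}[A](setUIDK _ (X c)).
apply: le_trans (lebesgue_outerU _ _) _; rewrite leeD2l//.
apply: le_trans (IH _ _) _ => [x [/AX[c' + xc'] xc]|].
  by rewrite inE => /orP[/eqP c'c|c's]; [rewrite -c'c in xc | exists c'].
by apply: lee_sum => c' _; apply: le_lebesgue_outer => x [[]].
Qed.

Lemma box_setI a b a' b' : box a b `&` box a' b' =
  box (\row_i Num.max (a 0 i) (a' 0 i)) (\row_i Num.min (b 0 i) (b' 0 i)).
Proof.
apply/seteqP; split=> [x [h h'] i|x h]; rewrite ?mxE.
  move: (h i) (h' i); rewrite gt_max le_min => /andP[p q] /andP[r t]; by rewrite p q r t.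
by split=> i; have := h i; rewrite !mxE gt_max le_min => /andP[/andP[p q] /andP[r t]]; apply/andP.
Qed.

End LebesgueOuter.

(** * Cells almost filled by a set *)

Section Grid.
Context {R : realType}.
Implicit Types (p q x y z a h : R).

Lemma len_cut p q x y z : x <= y <= z ->
  itv_len (Num.max p x, Num.min q y) + itv_len (Num.max p y, Num.min q z) <=
  itv_len (Num.max p x, Num.min q z).
Proof.
move=> /andP[xy yz]; rewrite /itv_len/=.
by case: (leP p x); case: (leP p y); case: (leP q y); case: (leP q z) => ? ? ? ?;
  repeat (case: (leP 0 (_ - _)) => ?); lra.
Qed.

Lemma sum_len_cut_le p q a h H : 0 <= h ->
  \sum_(j < H) itv_len (Num.max p (a + h * j%:R), Num.min q (a + h * j.+1%:R)) <= itv_len (p, q).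
Proof.
move=> h0; apply: (@le_trans _ _ (itv_len (Num.max p a, Num.min q (a + h * H%:R)))); last first.
  rewrite /itv_len/=; case: (leP p a); case: (leP q (a + h * H%:R)) => ? ?;
    repeat (case: (leP 0 (_ - _)) => ?); lra.
elim: H => [|H IH]; first by rewrite big_ord0 len_ge0.
rewrite big_ord_recr/=; apply: le_trans (lerD IH (lexx _)) _.
have H0 : 0 <= h * H%:R by rewrite mulr_ge0.
rewrite -[a in Num.max p a]addr0 -(mulr0 h).
by apply: len_cut; rewrite -natr1; lra.
Qed.

Lemma exists_cell_index (u : R) H : 0 < u <= H%:R ->
  exists j : 'I_H, j%:R < u <= j.+1%:R.
Proof.
elim: H => [|H IH] /andP[u0 uH]; first by move: (lt_le_trans u0 uH); rewrite ltxx.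
have [uH'|uH'] := leP u H%:R; last by exists ord_max; rewrite uH' uH.
have [|j ju] := IH; first by rewrite u0.
by exists (widen_ord (leqnSn H) j).
Qed.

(** One fixed coordinate leaves [d - 1] free ones; multiplying by [H] avoids a truncated
    exponent. *)
Lemma card_ffun_fix d H (i : 'I_d) (j : 'I_H) :
  (#|[set v : {ffun 'I_d -> 'I_H} | v i == j]%SET| * H = H ^ d)%N.
Proof.
pose F (k : 'I_d) : pred 'I_H := if k == i then pred1 j else predT.
have -> : #|[set v : {ffun 'I_d -> 'I_H} | v i == j]%SET| = #|(family F : simpl_pred _)|.
  apply: eq_card => v; rewrite !inE; apply/idP/familyP => [/eqP vi k|/(_ i)].
    by rewrite /F; case: eqP => // ->; rewrite inE vi.
  by rewrite /F eqxx inE.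
rewrite card_family foldrE big_map big_enum/= (bigD1 i)//= {1}/F eqxx card1 mul1n.
rewrite (eq_bigr (fun=> H)) => [|k /negbTE ki]; last by rewrite /F ki card_ord.
by rewrite prod_nat_const cardC1 card_ord -expnSr prednK// (leq_trans _ (ltn_ord i)).
Qed.

End Grid.

Section Cells.
Context {R : realType} {d : nat}.
Implicit Types (a p q x : 'rV[R]_d) (h : R) (X : set 'rV[R]_d).

Definition cell_lo a h H (v : {ffun 'I_d -> 'I_H}) : 'rV[R]_d :=
  \row_i (a 0 i + h * (v i)%:R).
Definition cell_hi a h H (v : {ffun 'I_d -> 'I_H}) : 'rV[R]_d :=
  \row_i (a 0 i + h * (v i).+1%:R).
Definition cell a h H (v : {ffun 'I_d -> 'I_H}) : set 'rV[R]_d :=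
  box (cell_lo a h H v) (cell_hi a h H v).

(** By [box_cellI], the volume of the part of [box p q] in the cell; the product form lets the sum
    over all cells factor into one sum per coordinate. *)
Definition cut_volume p q a h H (v : {ffun 'I_d -> 'I_H}) : R :=
  \prod_i itv_len (Num.max (p 0 i) (a 0 i + h * (v i)%:R),
               Num.min (q 0 i) (a 0 i + h * (v i).+1%:R)).

Lemma cut_volume_ge0 p q a h H v : 0 <= cut_volume p q a h H v.
Proof. by apply: prodr_ge0 => i _; exact: len_ge0. Qed.

Lemma box_cellI p q a h H v : exists p' q' : 'rV[R]_d,
  box p q `&` cell a h H v = box p' q' /\ box_volume p' q' = cut_volume p q a h H v.
Proof.
rewrite box_setI; do 2!eexists; split; first reflexivity.
by apply: eq_bigr => i _; rewrite !mxE.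
Qed.

Lemma box_volume_cell a h H v : 0 <= h ->
  box_volume (cell_lo a h H v) (cell_hi a h H v) = h ^+ d.
Proof.
move=> h0; rewrite /box_volume -[in RHS](card_ord d) -prodr_const.
apply: eq_bigr => i _; rewrite !mxE -natr1.
have -> (x y : R) : x + h * (y + 1) - (x + h * y) = h by ring.
exact: max_r.
Qed.

Lemma sum_cut_volume_le p q a h H : 0 <= h ->
  \sum_v cut_volume p q a h H v <= box_volume p q.
Proof.
move=> h0; rewrite -(bigA_distr_bigA (fun i (j : 'I_H) =>
  itv_len (Num.max (p 0 i) (a 0 i + h * j%:R), Num.min (q 0 i) (a 0 i + h * j.+1%:R)))).
apply: ler_prod => i _; rewrite sum_len_cut_le// andbT.
by apply: sumr_ge0 => j _; exact: len_ge0.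
Qed.

Lemma cell_cover a h H : 0 < h ->
  box a (\row_i (a 0 i + h * H%:R)) `<=` [set x | exists v, cell a h H v x].
Proof.
move=> h0 x xa.
have xi i : exists j : 'I_H, j%:R < (x 0 i - a 0 i) / h <= j.+1%:R.
  apply: exists_cell_index; have := xa i; rewrite mxE => /andP[ax xb].
  by rewrite divr_gt0 ?subr_gt0//= ler_pdivrMr// lerBlDl mulrC.
have [v vx] := choice xi; exists [ffun i => v i] => i; rewrite !mxE ffunE.
by have := vx i; rewrite ltr_pdivlMr// ler_pdivrMr// ltrBrDl lerBlDl ![_ * h]mulrC.
Qed.

(** A hyperplane carrying a face of [box p q] passes through the interior of the cell. By
    [cut_volumeP] any other cell is cut in full volume or in volume [0]. *)
Definition partial_cell p q a h H (v : {ffun 'I_d -> 'I_H}) : bool :=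
  [exists i, (a 0 i + h * (v i)%:R < p 0 i < a 0 i + h * (v i).+1%:R) ||
             (a 0 i + h * (v i)%:R < q 0 i < a 0 i + h * (v i).+1%:R)].

Lemma cut_volumeP p q a h H v : 0 < h ->
  [\/ cut_volume p q a h H v = h ^+ d, cut_volume p q a h H v = 0 |
      partial_cell p q a h H v].
Proof.
move=> h0; case: (boolP (partial_cell p q a h H v)) => [?|np]; first by constructor 3.
case: (pselect (exists i, a 0 i + h * (v i).+1%:R <= p 0 i \/
                          q 0 i <= a 0 i + h * (v i)%:R)) => [[i iout]|nout].
  constructor 2; rewrite /cut_volume (bigD1 i)//= [itv_len _](_ : _ = 0) ?mul0r//.
  rewrite /itv_len/=; apply: max_l; rewrite subr_le0.
  by case: iout => ?; rewrite ge_min !le_max; apply/orP; [right|left]; apply/orP; [left|right].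
constructor 1; rewrite /cut_volume -[in RHS](card_ord d) -prodr_const.
apply: eq_bigr => i _.
move: np; rewrite negb_exists => /forallP/(_ i); rewrite negb_or !negb_and -!leNgt.
have [pi1 qi1] : p 0 i < a 0 i + h * (v i).+1%:R /\ a 0 i + h * (v i)%:R < q 0 i.
  by split; rewrite ltNge; apply/negP => ?; apply: nout; exists i; [left|right].
move=> /andP[/orP[pi2|]]; last by rewrite leNgt pi1.
move=> /orP[|qi2]; first by rewrite leNgt qi1.
rewrite max_r// min_r// /itv_len/= -natr1.
have -> (x y : R) : x + h * (y + 1) - (x + h * y) = h by ring.
exact/max_r/ltW.
Qed.

(** Each of the [2 d] face hyperplanes runs inside at most one slab of cells, and a slab is a
    proportion [1 / H] of the grid. *)
Lemma card_partial_cell p q a h H : 0 < h ->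
  (#|[set v | partial_cell p q a h H v]%SET| * H <= 2 * d * H ^ d)%N.
Proof.
move=> h0.
have slab (i : 'I_d) (y : R) : (#|[set v : {ffun 'I_d -> 'I_H} |
    (a 0 i + h * (v i)%:R < y < a 0 i + h * (v i).+1%:R)%R]%SET| * H <= H ^ d)%N.
  set S := [set v | _]%SET; have [->|[v0 v0S]] := set_0Vmem S.
    by rewrite cards0.
  rewrite -(card_ffun_fix d H i (v0 i)) leq_mul2r; apply/orP; right; apply: subset_leq_card.
  apply/fintype.subsetP => v; rewrite !inE in v0S * => /andP[v1 v2]; move: v0S => /andP[v3 v4].
  have : (v i < (v0 i).+1)%N by rewrite -(ltr_nat R) -(ltr_pM2l h0); lra.
  have : (v0 i < (v i).+1)%N by rewrite -(ltr_nat R) -(ltr_pM2l h0); lra.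
  by rewrite -val_eqE/= eqn_leq !ltnS => -> ->.
pose S i y := [set v : {ffun 'I_d -> 'I_H} |
    (a 0 i + h * (v i)%:R < y < a 0 i + h * (v i).+1%:R)%R]%SET.
have sub : [set v | partial_cell p q a h H v]%SET \subset
    (\bigcup_i (S i (p 0 i) :|: S i (q 0 i)))%SET.
  apply/fintype.subsetP => v; rewrite inE => /existsP[i vi]; apply/bigcupP; exists i => //.
  by rewrite !inE.
have /leq_trans : (#|[set v | partial_cell p q a h H v]%SET| <=
    \sum_(i < d) (#|S i (p ord0 i)| + #|S i (q ord0 i)|))%N.
  apply: leq_trans (subset_leq_card sub) _.
  apply: (big_ind2 (fun (A : {set {ffun 'I_d -> 'I_H}}) n => (#|A| <= n)%N)).
  - by rewrite cards0.
  - by move=> A1 n1 A2 n2 H1 H2; rewrite (leq_trans (leq_card_setU _ _))// leq_add.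
  - by move=> i _; rewrite leq_card_setU.
move=> le1; rewrite (leq_trans (leq_mul (le1 _ (leqnn _)) (leqnn H)))//.
rewrite big_distrl/=.
have -> : (2 * d * H ^ d = \sum_(i < d) (H ^ d + H ^ d))%N.
  by rewrite sum_nat_const card_ord addnn -mul2n; lia.
by apply: leq_sum => i _; rewrite mulnDl leq_add// slab.
Qed.

End Cells.

(** * Many cells of nearly full density *)

Section DenseCells.
Context {R : realType} {d : nat}.
Hypothesis d_gt0 : (0 < d)%N.
Implicit Types (a : 'rV[R]_d) (X : set 'rV[R]_d) (I : nat -> 'rV[R]_d * 'rV[R]_d).

Lemma lebesgue_outer_cell X I a h H v :
  X `<=` \bigcup_k box (I k).1 (I k).2 ->
  (lebesgue_outer (X `&` cell a h H v) <=
     \sum_(k <oo) (cut_volume (I k).1 (I k).2 a h H v)%:E)%E.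
Proof.
move=> XI.
have /choice[J JP] k : exists J : 'rV[R]_d * 'rV[R]_d,
    box (I k).1 (I k).2 `&` cell a h H v = box J.1 J.2 /\
    box_volume J.1 J.2 = cut_volume (I k).1 (I k).2 a h H v.
  by have [p [q pq]] := box_cellI (I k).1 (I k).2 a h H v; exists (p, q).
under eq_eseriesr do rewrite -(JP _).2.
apply: lebesgue_outer_le_cover => x [/XI[k _ xk] xv]; exists k => //.
by rewrite -(JP k).1.
Qed.

Lemma sum_cut_series_le I a h H n : 0 <= h ->
  (\sum_v \sum_(n <= k <oo) (cut_volume (I k).1 (I k).2 a h H v)%:E <=
   \sum_(n <= k <oo) (box_volume (I k).1 (I k).2)%:E)%E.
Proof.
move=> h0; rewrite -nneseries_sum; last first.
  by move=> v k _; rewrite lee_fin cut_volume_ge0.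
apply: lee_nneseries => k _.
  by move=> _; apply: sume_ge0 => v _; rewrite lee_fin cut_volume_ge0.
by rewrite sumEFin lee_fin sum_cut_volume_le.
Qed.

(** Take a cover of [X] by boxes optimal up to [sigma], single out its first [n] boxes, and cut so
    finely that their faces cross few cells. Of the other cells, those missing all [n] boxes see
    only the tail of the cover, and those inside one of them are almost filled by [X] unless they
    waste cover. *)
Lemma dense_cells a X (l beta kappa : R) : 0 < l -> 0 < beta -> 0 < kappa <= 1 ->
  X `<=` box a (\row_i (a 0 i + l)) -> ((beta * l ^+ d)%:E <= lebesgue_outer X)%E ->
  exists H, (0 < H)%N /\ exists D : {set {ffun 'I_d -> 'I_H}},
    beta / 2 * H%:R ^+ d <= #|D|%:R /\
    forall v, v \in D ->
      (((1 - kappa) * (l / H%:R) ^+ d)%:E <= lebesgue_outer (X `&` cell a (l / H%:R) H v))%E.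
Proof.
move=> l0 beta0 /andP[kappa0 kappa1] Xa Xbeta.
have ld0 : 0 < l ^+ d by rewrite exprn_gt0.
have Xfin : lebesgue_outer X \is a fin_num.
  rewrite ge0_fin_numE ?lebesgue_outer_ge0//.
  apply: le_lt_trans (le_lebesgue_outer _ _ Xa) _.
  by rewrite lebesgue_outer_box// ltry.
pose mX := fine (lebesgue_outer X).
have mXE : lebesgue_outer X = mX%:E by rewrite fineK.
have mXbeta : beta * l ^+ d <= mX by rewrite -lee_fin -mXE.
(* Makes [sigma / kappa] equal to [beta * l ^ d / 8], the budget of each of three errors;
   [kappa <= 1] keeps [sigma] itself within it. *)
pose sigma := kappa * (beta * l ^+ d) / 8.
have sigma0 : 0 < sigma by rewrite divr_gt0// !mulr_gt0.
have sigma1 : sigma <= beta * l ^+ d / 8.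
  by rewrite ler_pM2r ?invr_gt0// ler_piMl// ltW// mulr_gt0.
have [I XI sI] : exists2 I, X `<=` \bigcup_k box (I k).1 (I k).2 &
    (\sum_(k <oo) (box_volume (I k).1 (I k).2)%:E < (mX + sigma)%:E)%E.
  by apply: lebesgue_outer_lt_cover; rewrite mXE lte_fin ltrDl.
have vol0 k : (0 <= (box_volume (I k).1 (I k).2)%:E)%E by rewrite lee_fin box_volume_ge0.
have [n tail_n] : exists n, (\sum_(n <= k <oo) (box_volume (I k).1 (I k).2)%:E <= sigma%:E)%E.
  have := @nneseries_tail_cvg _ _ predT (lt_trans sI (ltry _)) (fun k _ => vol0 k).
  move=> /fine_cvgP[fin_tail /cvgrPdist_le/(_ _ sigma0) tail_le].
  have [n _ /(_ n (leqnn n))[finn]] := filterI fin_tail tail_le.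
  rewrite /= sub0r normrN => tn; exists n.
  by rewrite -(fineK finn) lee_fin (le_trans (ler_norm _)).
(* The [2 d n] face hyperplanes cross at most [2 d n H0 ^ d / H0] cells, less than [beta / 8] of the
   grid. *)
have [H0 H0P] : exists H : nat, 16 * n%:R * d%:R / beta < H%:R.
  exists (Num.truncn (16 * n%:R * d%:R / beta)).+1; exact: truncnS_gt.
have Hgt0 : (0 < H0)%N.
  by rewrite -(ltr_nat R) (le_lt_trans _ H0P)// divr_ge0 ?(ltW beta0)// !mulr_ge0.
have HR0 : (0 : R) < H0%:R by rewrite ltr0n.
exists H0; split => //.
set h := l / H0%:R.
have h0 : 0 < h by rewrite divr_gt0.
have lE : l = h * H0%:R by rewrite divfK// gt_eqF.
have ldE : l ^+ d = h ^+ d * H0%:R ^+ d by rewrite [in LHS]lE; exact: exprMn.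
have hd0 : 0 < h ^+ d by rewrite exprn_gt0.
pose U v := (\sum_(k <oo) (cut_volume (I k).1 (I k).2 a h H0 v)%:E)%E.
pose T v := (\sum_(n <= k <oo) (cut_volume (I k).1 (I k).2 a h H0 v)%:E)%E.
pose M v := lebesgue_outer (X `&` cell a h H0 v).
have cut0 k v : (0 <= (cut_volume (I k).1 (I k).2 a h H0 v)%:E)%E.
  by rewrite lee_fin cut_volume_ge0.
have U0 v : (0 <= U v)%E by exact: nneseries_ge0.
have T0 v : (0 <= T v)%E by exact: nneseries_ge0.
have MU v : (M v <= U v)%E by exact: lebesgue_outer_cell.
have Mh v : (M v <= (h ^+ d)%:E)%E.
  rewrite -(box_volume_cell a h H0 v (ltW h0)) -lebesgue_outer_box//.
  by apply: le_lebesgue_outer => x [].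
have TU v : (T v <= U v)%E.
  rewrite /U (nneseries_split 0 n)//= add0n leeDr//.
  exact: sume_ge0.
have sumU : (\sum_v U v <= (mX + sigma)%:E)%E.
  exact: le_trans (sum_cut_series_le _ _ _ _ _ (ltW h0)) (ltW sI).
have sumT : (\sum_v T v <= sigma%:E)%E.
  exact: le_trans (sum_cut_series_le _ _ _ _ _ (ltW h0)) tail_n.
have sumM : (mX%:E <= \sum_v M v)%E.
  rewrite -mXE; apply: lebesgue_outer_sum_le => // x Xx.
  have : box a (\row_i (a 0 i + h * H0%:R)) x by rewrite -lE; exact: Xa.
  by move=> /(cell_cover _ _ _ h0)[v xv]; exists v => //; rewrite mem_index_enum.
have Ufin v : U v \is a fin_num.
  rewrite ge0_fin_numE//; apply: le_lt_trans (ltry (mX + sigma)).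
  by apply: le_trans sumU; rewrite (bigD1 v)//= leeDl// sume_ge0.
have Tfin v : T v \is a fin_num.
  by rewrite ge0_fin_numE// (le_lt_trans (TU v))// -ge0_fin_numE.
have Mfin v : M v \is a fin_num.
  by rewrite ge0_fin_numE ?lebesgue_outer_ge0// (le_lt_trans (MU v))// -ge0_fin_numE.
pose u v := fine (U v); pose t v := fine (T v); pose m v := fine (M v).
have UE v : U v = (u v)%:E by rewrite fineK.
have TE v : T v = (t v)%:E by rewrite fineK.
have ME v : M v = (m v)%:E by rewrite fineK.
have {}sumU : \sum_v u v <= mX + sigma.
  by rewrite -lee_fin -sumEFin; under eq_bigr do rewrite -UE.
have {}sumT : \sum_v t v <= sigma.
  by rewrite -lee_fin -sumEFin; under eq_bigr do rewrite -TE.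
have {}sumM : mX <= \sum_v m v.
  by rewrite -lee_fin -sumEFin; under eq_bigr do rewrite -ME.
have mu v : m v <= u v by rewrite -lee_fin -ME -UE.
have mh v : m v <= h ^+ d by rewrite -lee_fin -ME.
have t0 v : 0 <= t v by rewrite -lee_fin -TE.
pose D := [set v : {ffun 'I_d -> 'I_H0} | (1 - kappa) * h ^+ d <= m v]%SET.
pose part := (\bigcup_(k < n) [set v | partial_cell (I k).1 (I k).2 a h H0 v])%SET.
exists D; split; last by move=> v; rewrite inE -/(M v) ME lee_fin.
(* A cell outside [D] contained in one of the first [n] boxes wastes [kappa h^d]
   of the cover, and the cover wastes at most [sigma] altogether. *)
have pointwise v : m v <= h ^+ d * (v \in D)%:R + (u v - m v) / kappa + t v
     + h ^+ d * (v \in part)%:R.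
  have um0 : 0 <= (u v - m v) / kappa by rewrite divr_ge0 ?subr_ge0// ltW.
  have [vD|vD] := boolP (v \in D).
    have := mh v; have := t0 v; have : 0 <= h ^+ d * (v \in part)%:R.
      by rewrite mulr_ge0// ltW.
    by rewrite mulr1; lra.
  have [vp|vp] := boolP (v \in part).
    by have := mh v; have := t0 v; rewrite mulr1 mulr0; lra.
  rewrite !mulr0 add0r addr0.
  have np k : (k < n)%N -> ~~ partial_cell (I k).1 (I k).2 a h H0 v.
    move=> kn; apply: contra vp => kp; apply/bigcupP.
    by exists (Ordinal kn) => //; rewrite inE.
  have [[k [kn kv]]|nocov] := pselect (exists k, (k < n)%N /\
      cut_volume (I k).1 (I k).2 a h H0 v = h ^+ d).
    have hu : h ^+ d <= u v.
      rewrite -lee_fin -UE /U (nneseriesD1 (n := k))// kv leeDl//.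
      exact: nneseries_ge0.
    have : h ^+ d <= (u v - m v) / kappa.
      by rewrite ler_pdivlMr//; move: vD; rewrite inE -ltNge; lra.
    by have := mh v; have := t0 v; lra.
  suff : u v = t v by have := mu v; lra.
  rewrite /u /U (nneseries_split 0 n)//= add0n big_nat big1 ?add0e// => k kn.
  have [kv|->//|kv] := cut_volumeP (I k).1 (I k).2 a h H0 v h0.
    by exfalso; apply: nocov; exists k.
  by move: (np k kn); rewrite kv.
have := ler_sum (index_enum _) (fun v (_ : true) => pointwise v).
move=> /=.
rewrite !big_split/= -!mulr_suml -!mulr_sumr sumrB.
have cardE (S : {set {ffun 'I_d -> 'I_H0}}) : \sum_v (v \in S)%:R = #|S|%:R :> R.
  rewrite -sum1_card natr_sum [RHS]big_mkcond/=; apply: eq_bigr => v _.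
  by case: (v \in S).
rewrite !cardE => main.
have part_le : h ^+ d * #|part|%:R <= beta * l ^+ d / 8.
  have : (#|part| * H0 <= n * (2 * d * H0 ^ d))%N.
    apply: (@leq_trans (\sum_(k < n)
        #|[set v | partial_cell (I k).1 (I k).2 a h H0 v]%SET| * H0)%N).
      rewrite -big_distrl leq_mul2r; apply/orP; right; rewrite /part.
      apply: (big_ind2 (fun (A : {set {ffun 'I_d -> 'I_H0}}) n => (#|A| <= n)%N)).
      - by rewrite cards0.
      - by move=> A1 n1 A2 n2 H1 H2; rewrite (leq_trans (leq_card_setU _ _))// leq_add.
      - by [].
    rewrite -[X in (_ <= X * _)%N]card_ord -sum_nat_const.
    by apply: leq_sum => k _; exact: card_partial_cell.
  rewrite -(ler_nat R) !natrM natrX => le_part.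
  rewrite ldE -(ler_pM2r HR0) -[leLHS]mulrA.
  apply: le_trans (ler_wpM2l (ltW hd0) le_part) _.
  have := H0P; rewrite ltr_pdivrMr// => /ltW H0le.
  have := ler_wpM2l (mulr_ge0 (ltW hd0) (exprn_ge0 d (ltW HR0))) H0le.
  lra.
have um_le : (\sum_v u v - \sum_v m v) / kappa <= beta * l ^+ d / 8.
  rewrite ler_pdivrMr// mulrAC [_ * kappa]mulrC -/sigma.
  by move: sumU sumM; lra.
have e1 : h ^+ d * (beta / 2 * H0%:R ^+ d) = beta * l ^+ d / 2 by rewrite ldE; ring.
have e2 : 0 < beta * l ^+ d by rewrite mulr_gt0.
rewrite -(ler_pM2l hd0) e1.
(* Three errors of at most one eighth leave five eighths of [beta * l ^ d], more than the required
   half. *)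
have {}main : \sum_v m v <= h ^+ d * #|D|%:R + beta * l ^+ d / 8 + sigma + beta * l ^+ d / 8.
  by apply: le_trans main _; rewrite !lerD.
move: main mXbeta sigma1 sumM e2.
move: (h ^+ d * #|D|%:R) (beta * l ^+ d) (\sum_v m v) => x1 x2 x3.
clear -x1; lra.
Qed.

End DenseCells.

(** * Convex bodies and measures on their boundaries *)

Section ConvexBody.
Context {R : realType} {d : nat} (K : set 'rV[R]_d).
Hypothesis bodyK : symmetric_convex_body K.
Implicit Types x y z : 'rV[R]_d.

Lemma body_convex x y (l : R) : 0 <= l <= 1 -> K x -> K y -> K (l *: x + (1 - l) *: y).
Proof.
move=> /andP[l0 l1] Kx Ky; have [convK _ _ _] := bodyK.
by have := convK x y (Itv01 l0 l1) (mem_set Kx) (mem_set Ky); rewrite inE.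
Qed.

Lemma body_opp x : K x -> K (- x).
Proof. by have [_ _ _ KN] := bodyK; rewrite -{2}KN => Kx; exists x. Qed.

Lemma body_ball0 : exists2 e : R, 0 < e & forall z, `|z| < e -> K z.
Proof.
have [_ _ [c /nbhs_ballP[e /= e0 ceK]] _] := bodyK; exists e => // z ze.
have cz (u : 'rV[R]_d) : `|u| < e -> K (c - u).
  by move=> ue; apply: ceK; rewrite -ball_normE /ball_/= opprB addrC subrK.
(* [z] is the midpoint of [c + z], near the interior point [c], and of [z - c], the opposite of a
   point near [c]. *)
have -> : z = (1 / 2) *: (c - - z) + (1 - 1 / 2) *: (- (c - z)).
  by apply/rowP => i; rewrite !mxE; field.
apply: body_convex; first by lra.
  by apply: cz; rewrite normrN.
exact/body_opp/cz.
Qed.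

Lemma body0 : K 0.
Proof. by have [e e0] := body_ball0; apply; rewrite normr0. Qed.

Lemma body_closed : closed K.
Proof. by have [_ cK _ _] := bodyK; apply: compact_closed cK; exact: norm_hausdorff. Qed.

Lemma boundary_body y : boundary K y -> K y.
Proof. by case; rewrite -(closure_id K).1//; exact: body_closed. Qed.

(** If [l *: y] were in [K], the homothety centred there with ratio [1 - l^-1] would carry a ball of
    [K] around [0] onto a ball of [K] around [y]. *)
Lemma boundary_out y (l : R) : boundary K y -> 1 < l -> ~ K (l *: y).
Proof.
move=> [_ yint] l1 Kly; apply: yint; have [e e0 eK] := body_ball0.
have l0 : 0 < l by lra.
have r0 : 0 < 1 - l^-1 by rewrite subr_gt0 invf_lt1.
apply/nbhs_ballP; exists ((1 - l^-1) * e) => /=; first by rewrite mulr_gt0.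
move=> u; rewrite -ball_normE /ball_/= distrC => yu.
have -> : u = l^-1 *: (l *: y) + (1 - l^-1) *: ((1 - l^-1)^-1 *: (u - y)).
  by rewrite !scalerA mulVf ?mulfV ?gt_eqF// !scale1r addrC subrK.
apply: body_convex => //; first by rewrite invr_ge0 ltW//= invf_le1// ltW.
by apply: eK; rewrite normrZ gtr0_norm ?invr_gt0// mulrC ltr_pdivrMr// mulrC.
Qed.

Lemma body_norm_boundary y (t : R) : boundary K y -> 0 < t -> body_norm K (t *: y) = t.
Proof.
move=> yK t0; rewrite /body_norm.
have -> : [set s | 0 <= s /\ ~ [set s *: y0 | y0 in K] (t *: y)] = `[0, t[%classic.
  apply/seteqP; split=> s /=; rewrite in_itv/=.
    move=> [s0 sK]; rewrite s0/= ltNge; apply/negP => ts; apply: sK.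
    have sgt0 : 0 < s by exact: lt_le_trans ts.
    exists (t / s *: y); last by rewrite scalerA mulrC divfK// gt_eqF.
    have -> : t / s *: y = (t / s) *: y + (1 - t / s) *: 0 by rewrite scaler0 addr0.
    apply: body_convex (boundary_body _ yK) body0.
    by apply/andP; split; [exact/ltW/divr_gt0|rewrite ler_pdivrMr// mul1r].
  move=> /andP[s0 st]; split=> // -[k Kk kE].
  have st0 : 0 < s + t by lra.
  (* From [s *: k = t *: y], the multiple [2 t / (s + t) > 1] of [y] equals a multiple of [k] by a
     factor at most [1]. Unlike [t / s], this choice also covers [s = 0]. *)
  apply: (@boundary_out y (2 * t / (s + t))) => //.
    by rewrite ltr_pdivlMr// mul1r; lra.
  have -> : (2 * t / (s + t)) *: y = (2 * s / (s + t)) *: k + (1 - 2 * s / (s + t)) *: 0.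
    rewrite scaler0 addr0 [2 * t]mulrC [2 * s]mulrC -!mulrA ![_ * (2 / _)]mulrC.
    by rewrite -!scalerA kE.
  apply: body_convex Kk body0.
  apply/andP; split; last by rewrite ler_pdivrMr//; lra.
  by rewrite divr_ge0 ?mulr_ge0// ltW.
by rewrite sup_itv// bnd_simp.
Qed.

Lemma ler_coord_norm y i : `|y 0 i| <= `|y|.
Proof. by rewrite [leRHS]mx_normrE; exact: (le_bigmax _ (fun ij => `|y ij.1 ij.2|) (0, i)). Qed.

Lemma boundary_bounded : exists2 B : R, 0 < B & forall y, boundary K y -> forall i, `|y 0 i| <= B.
Proof.
have [_ cK _ _] := bodyK.
have [M [_ MB]] := compact_bounded cK.
exists (Num.max 1 (M + 1)); first by rewrite lt_max ltr01.
move=> y /boundary_body Ky i; apply: le_trans (ler_coord_norm y i) _.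
by apply: MB => //; rewrite lt_max; apply/orP; right; rewrite ltrDl.
Qed.

End ConvexBody.

(** * Real part of the Fourier transform of a probability measure *)

Section FourierOfProbability.
Context {R : realType} {d : nat} (mu : probability (borel R d) R).
Implicit Types (y xi : 'rV[R]_d).

Lemma borel_open_measurable (A : set 'rV[R]_d) :
  open A -> measurable (A : set (borel R d)).
Proof. by move=> oA; exact: sub_sigma_algebra. Qed.

Lemma continuous_borel_measurable (f : 'rV[R]_d -> R) :
  continuous f -> measurable_fun [set: borel R d] (f : borel R d -> R).
Proof.
move=> /continuousP fo.
apply: (measurability _ (RGenOInfty.measurableE R)) => _ [_ [x ->] <-].
by rewrite setTI; apply: borel_open_measurable; apply: fo; exact: rray_open.
Qed.

Definition phase y xi : R := cos (2 * pi * dot y xi).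

Lemma measurable_phase xi :
  measurable_fun [set: borel R d] (phase^~ xi : borel R d -> R).
Proof.
apply: (measurableT_comp (f := cos)).
  by apply: (continuous_measurable_fun (f := cos)); exact: continuous_cos.
apply: measurable_funM => //; apply: measurable_sum => i.
apply: measurable_funM => //; apply: continuous_borel_measurable.
exact: coord_continuous.
Qed.

Variable S : set 'rV[R]_d.
Hypotheses (mS : measurable (S : set (borel R d))) (muS : mu S = 1%E).

Lemma integrable_phase (D : set (borel R d)) xi : measurable D ->
  mu.-integrable D (EFin \o (phase^~ xi : borel R d -> R)).
Proof.
move=> mD; apply: (@le_integrable _ _ _ _ _ mD _ (EFin \o cst (1 : R))).
- by apply/measurable_EFinP; apply: measurable_funTS; exact: measurable_phase.
- by move=> y _; rewrite lee_fin /= normr1 cos_max.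
exact: finite_measure_integrable_cst.
Qed.

Definition refourier xi : R := complex.Re (fourier mu xi).

Lemma refourierE xi : refourier xi = \int[mu]_(y in S) phase y xi.
Proof.
rewrite /refourier /fourier /complex_integral /= /Rintegral.
rewrite (negligible_integral (N := ~` (S : set (borel R d)))) //.
- by rewrite setDE setCK setTI; under eq_integral do rewrite cosN.
- exact: measurableC.
- apply: eq_integrable (integrable_phase setT xi measurableT) => //.
  by move=> y _ /=; rewrite cosN.
- by apply: etrans (@probability_setC _ _ _ mu _ mS) _; rewrite muS subee.
Qed.

(** Integration over the full-measure set [S] is linear and monotone, and a constant integrates to
    itself, so a pointwise bound on [S] passes to the transforms. *)
Lemma sum_refourier_le (T : eqType) (s : seq T) (c : T -> R) (f : T -> 'rV[R]_d) (r : R) :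
  (forall y, S y -> \sum_(e <- s) c e * phase y (f e) <= r) ->
  \sum_(e <- s) c e * refourier (f e) <= r.
Proof.
move=> ler.
have [intS ->] : mu.-integrable S
     (EFin \o (fun y : borel R d => \sum_(e <- s) c e * phase y (f e))) /\
    \sum_(e <- s) c e * refourier (f e) =
    \int[mu]_(y in S) (\sum_(e <- s) c e * phase y (f e)).
  elim: s {ler} => [|e s [IHi IHe]].
    rewrite big_nil /Rintegral; under [in X in _ /\ X]eq_integral do rewrite big_nil.
    rewrite integral0; split => //.
    by under eq_fun do rewrite /= big_nil; exact: integrable0.
  have inte : mu.-integrable S
      (EFin \o (fun y : borel R d => c e * phase y (f e))).
    exact: (@integrableZl _ _ _ _ _ mS (c e) _ (integrable_phase _ _ mS)).
  split.
    apply: eq_integrable (integrableD mS inte IHi) => // y _.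
    by rewrite /= big_cons EFinD.
  rewrite big_cons IHe refourierE -RintegralZl ?integrable_phase// -RintegralD//.
  by apply: eq_Rintegral => y _; rewrite big_cons.
have e : r = \int[mu]_(y in S) r.
  rewrite Rintegral_cst; last exact: mS.
  by rewrite -[LHS]mulr1; congr (_ * _); exact: esym (congr1 fine muS).
rewrite [leRHS]e.
apply: le_Rintegral => //.
exact: finite_measure_integrable_cst.
Qed.

Lemma refourier_ge (r : R) xi : (forall y, S y -> r <= phase y xi) -> r <= refourier xi.
Proof.
move=> rle; have := @sum_refourier_le _ [:: xi] (fun=> -1) id (- r).
rewrite big_seq1 mulN1r lerN2; apply => y /rle.
by rewrite big_seq1 mulN1r lerN2.
Qed.

Lemma refourier0 : refourier 0 = 1.
Proof.
apply/eqP; rewrite eq_le; apply/andP; split.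
  have := @sum_refourier_le _ [:: 0] (fun=> 1) id 1.
  rewrite big_seq1 mul1r; apply => y _.
  by rewrite big_seq1 mul1r cos_le1.
by apply: refourier_ge => y _; rewrite /phase dot0r mulr0 cos0.
Qed.

Lemma refourier_good (eta : R) xi : `|fourier mu xi| <= eta%:C%C -> - eta <= refourier xi.
Proof.
move=> le_eta; have := le_trans (normc_ge_Re _) le_eta.
by rewrite lecR ler_norml => /andP[].
Qed.

End FourierOfProbability.

(** * Points in the filled cells *)

Section DensityToCells.
Context {R : realType} {d : nat}.
Hypothesis d_gt0 : (0 < d)%N.
Implicit Types (a x z : 'rV[R]_d) (A : set 'rV[R]_d).

Lemma dense_cube A (eps : R) (l0 : R) : 0 < eps -> upper_density A = eps%:E ->
  exists2 l : R, l0 < l /\ 0 < l & exists a,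
    ((eps / 2 * l ^+ d)%:E <= lebesgue_outer (A `&` cube a l))%E.
Proof.
move=> eps0 Aeps.
pose f l := ereal_sup [set (lebesgue_outer (A `&` cube a l)
                    / lebesgue_outer (cube a l))%E | a in [set: 'rV[R]_d]].
pose V := [set l : R | Num.max 0 l0 < l].
have VF : pinfty_nbhs R V.
  by exists (Num.max 0 l0); split => //; rewrite num_real.
have : ((eps / 2)%:E < ereal_sup [set f l | l in V])%E.
  apply: (@lt_le_trans _ _ eps%:E); first by rewrite lte_fin; lra.
  rewrite -Aeps /upper_density limf_esupE; apply: ereal_inf_lbound.
  by exists V.
move=> /ereal_sup_gt[_ [l lV <-]] /ereal_sup_gt[_ [a _ <-]] la.
move: lV; rewrite /V /= gt_max => /andP[lgt0 ll0].
exists l => //; exists a.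
(* Clearing the quotient of extended reals takes a positive and finite cube measure: a half-open box
   inside the cube and a larger one around it provide both. *)
have cube_ge : ((l ^+ d)%:E <= lebesgue_outer (cube a l))%E.
  have -> : l ^+ d = box_volume a (a + const_mx l).
    rewrite /box_volume -[in LHS](card_ord d) -prodr_const; apply: eq_bigr => i _.
    by rewrite !mxE (_ : a 0 i + l - a 0 i = l) ?max_r ?ltW//; ring.
  apply: le_trans (lebesgue_outer_box_ge _ _) _; apply: le_lebesgue_outer => x xa i.
  by have := xa i; rewrite !mxE => /andP[/ltW -> ->].
have cube_fin : lebesgue_outer (cube a l) \is a fin_num.
  rewrite ge0_fin_numE ?lebesgue_outer_ge0//.
  apply: (@le_lt_trans _ _ (lebesgue_outer (box (a - const_mx 1) (a + const_mx l)))).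
    apply: le_lebesgue_outer => x xa i; have := xa i; rewrite !mxE => /andP[ax ->].
    by rewrite andbT; lra.
  by rewrite lebesgue_outer_box// ltry.
move: cube_ge la; rewrite -(fineK cube_fin); set q := fine _; rewrite lee_fin => lq.
have q0 : 0 < q by rewrite (lt_le_trans _ lq)// exprn_gt0.
rewrite inver gt_eqF// lte_pdivlMr// => /ltW; apply: le_trans.
by rewrite lee_fin ler_pM2l// divr_gt0.
Qed.

(** A closed cube of side [l] lies in a half-open box of side [2 l]; doubling the side costs the
    factor [2 ^ d] in density. *)
Lemma dense_box A (eps l0 : R) : 0 < eps -> upper_density A = eps%:E ->
  exists2 l : R, l0 < l /\ 0 < l & exists a,
    ((eps / 2 / 2 ^+ d * l ^+ d)%:E <=
       lebesgue_outer (A `&` box a (\row_i (a 0 i + l))%R))%E.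
Proof.
move=> eps0 /(dense_cube A eps l0 eps0)[l [ll0 lgt0] [a aA]].
exists (2 * l); first by split; lra.
exists (a - const_mx l).
have -> : eps / 2 / 2 ^+ d * (2 * l) ^+ d = eps / 2 * l ^+ d.
  by rewrite exprMn mulrA divfK// expf_neq0// pnatr_eq0.
apply: le_trans aA _; apply: le_lebesgue_outer => x [Ax xa]; split=> // i.
by have := xa i; rewrite !mxE => /andP[]; lra.
Qed.

(* The overlap of [c'] with the translate [c + z] has more volume than the
   complement of [A] in the two cells. *)
Lemma dense_cells_meet A a (h : R) H (v v' : {ffun 'I_d -> 'I_H}) z :
  lebesgue_measurable A -> 0 < h ->
  (((1 - (4 * 2 ^+ d)^-1) * h ^+ d)%:E <= lebesgue_outer (A `&` cell a h H v))%E ->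
  (((1 - (4 * 2 ^+ d)^-1) * h ^+ d)%:E <= lebesgue_outer (A `&` cell a h H v'))%E ->
  (forall i, `|h * (v' i)%:R - h * (v i)%:R - z 0 i| <= h / 2) ->
  exists2 x, A x & A (x - z).
Proof.
move=> mA h0 Av Av' vz; set kappa := (_^-1) in Av Av'.
have hd0 : 0 < h ^+ d by rewrite exprn_gt0.
have kappa0 : 0 < kappa by rewrite invr_gt0 mulr_gt0// exprn_gt0.
(* Caratheodory measurability of [A], tested on the cell, turns the lower bound on the filled part
   into an upper bound on the rest. *)
have missing (w : {ffun 'I_d -> 'I_H}) :
    (((1 - kappa) * h ^+ d)%:E <= lebesgue_outer (A `&` cell a h H w))%E ->
    (lebesgue_outer (cell a h H w `&` ~` A) <= (kappa * h ^+ d)%:E)%E.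
  move=> Aw; have := mA (cell a h H w).
  rewrite lebesgue_outer_box// (box_volume_cell _ _ _ _ (ltW h0)) (setIC (cell a h H w) A) => e.
  have fin1 : lebesgue_outer (A `&` cell a h H w) \is a fin_num.
    rewrite ge0_fin_numE ?lebesgue_outer_ge0// (le_lt_trans _ (ltry (h ^+ d)))// e.
    by rewrite leeDl// lebesgue_outer_ge0.
  have fin2 : lebesgue_outer (cell a h H w `&` ~` A) \is a fin_num.
    rewrite ge0_fin_numE ?lebesgue_outer_ge0// (le_lt_trans _ (ltry (h ^+ d)))// e.
    by rewrite leeDr// lebesgue_outer_ge0.
  move: Aw e; rewrite -(fineK fin1) -(fineK fin2) -EFinD !lee_fin => Aw [e].
  by move: Aw; rewrite e; lra.
apply: contrapT => noAA.
pose lo := \row_i Num.max (cell_lo a h H v' 0 i) (cell_lo a h H v 0 i + z 0 i).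
pose hi := \row_i Num.min (cell_hi a h H v' 0 i) (cell_hi a h H v 0 i + z 0 i).
have sub : box lo hi `<=` (cell a h H v' `&` ~` A) `|`
    [set x : 'rV[R]_d | (cell a h H v `&` ~` A) (x - z)].
  move=> x xI.
  have xv' : cell a h H v' x.
    by move=> i; have := xI i; rewrite !mxE gt_max le_min => /andP[/andP[-> _]/andP[-> _]].
  have xv : cell a h H v (x - z).
    move=> i; have := xI i; rewrite !mxE gt_max le_min => /andP[/andP[_ h1]/andP[_ h2]].
    by rewrite ltrBrDr h1 lerBlDr h2.
  have [Ax|Ax] := pselect (A x); last by left.
  by right; split=> // Axz; apply: noAA; exists x.
have vol : (h / 2) ^+ d <= box_volume lo hi.
  rewrite /box_volume -[in leLHS](card_ord d) -prodr_const.
  apply: ler_prod => i _; apply/andP; split; first by lra.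
  rewrite le_max; apply/orP; right; have := vz i.
  rewrite ler_norml !mxE -[(v i).+1%:R]natr1 -[(v' i).+1%:R]natr1 => /andP[h1 h2].
  rewrite lerBrDr le_min -!lerBrDl !ge_max.
  by apply/andP; split; apply/andP; split; lra.
have := le_trans (lebesgue_outer_box_ge lo hi) (le_lebesgue_outer _ _ sub).
move=> /le_trans /(_ (lebesgue_outerU _ _)).
move=> /le_trans /(_ (leeD (missing _ Av') (le_trans (lebesgue_outer_translate _ _) (missing _ Av)))).
(* The two missing parts measure at most [2 kappa h ^ d], which is half of [(h / 2) ^ d]. *)
rewrite -EFinD lee_fin leNgt => /negP; apply; apply: lt_le_trans vol.
rewrite expr_div_n -mulrDl mulrC ltr_pM2l// /kappa invfM.
have : 0 < (2 ^+ d)^-1 :> R by rewrite invr_gt0 exprn_gt0.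
lra.
Qed.

End DensityToCells.

(** * Geometric decay against polynomial growth *)

Lemma bernoulli_ineq {R : realType} (u : R) n : 0 <= u -> n%:R * u <= (1 + u) ^+ n.
Proof.
move=> u0; suff : 1 + n%:R * u <= (1 + u) ^+ n by lra.
elim: n => [|n IH]; first by rewrite mul0r addr0.
rewrite exprS; apply: le_trans (ler_wpM2l _ IH); last by lra.
have : 0 <= n%:R * u * u by rewrite !mulr_ge0.
by rewrite -natr1; lra.
Qed.

(** Bernoulli bounds [rho ^ n] by [1 / (n u)]; the power [d + 1] of this gains one factor [n] over
    the polynomial, and a large [n] absorbs the constants. Multiples of [m] are wanted since the
    grid has [8 H r] points per period. *)
Lemma poly_geometric {R : realType} (rho c : R) (m d : nat) : (0 < m)%N ->
  0 < rho < 1 -> 0 < c -> exists2 k, (0 < k)%N & (m * k)%:R ^+ d * rho ^+ (m * k) <= c.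
Proof.
move=> m0 /andP[rho0 rho1] c0.
pose u := rho^-1 - 1.
have u0 : 0 < u by rewrite subr_gt0 invf_gt1.
have u1 : 1 + u = rho^-1 by rewrite addrC subrK.
have mR : (0 : R) < m%:R by rewrite ltr0n.
pose b := d.+1%:R ^+ d / (u ^+ d.+1 * c).
pose k := (Num.truncn b).+1.
have kb : b < k%:R by exact: truncnS_gt.
have k0 : (0 : R) < k%:R by rewrite ltr0n.
exists (d.+1 * k)%N => //.
have mk0 : 0 < (m * k)%:R :> R by rewrite natrM mulr_gt0.
have le1 : ((m * k)%:R * u) ^+ d.+1 * rho ^+ (m * (d.+1 * k)) <= 1.
  have -> : (m * (d.+1 * k) = m * k * d.+1)%N by rewrite mulnCA mulnC.
  rewrite exprM -exprMn; apply: exprn_ile1.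
    by rewrite mulr_ge0 ?exprn_ge0 ?mulr_ge0// ltW.
  have := bernoulli_ineq u (m * k) (ltW u0); rewrite u1 exprVn => le2.
  by rewrite -ler_pdivlMr ?exprn_gt0// mul1r.
have e : (m * (d.+1 * k))%:R ^+ d = d.+1%:R ^+ d * (m * k)%:R ^+ d :> R.
  by rewrite mulnCA natrM exprMn.
rewrite e; set X := rho ^+ _ in le1 *.
have X0 : 0 < X by rewrite exprn_gt0.
rewrite -(ler_pM2l (exprn_gt0 d.+1 u0)) -(ler_pM2l mk0).
have -> : (m * k)%:R * (u ^+ d.+1 * (d.+1%:R ^+ d * (m * k)%:R ^+ d * X)) =
   d.+1%:R ^+ d * (((m * k)%:R * u) ^+ d.+1 * X).
  by rewrite exprMn [(m * k)%:R ^+ d.+1]exprS; ring.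
apply: (@le_trans _ _ (d.+1%:R ^+ d)); first by rewrite ler_piMr// exprn_ge0.
have uc : 0 < u ^+ d.+1 * c by rewrite mulr_gt0// exprn_gt0.
move: kb; rewrite /b ltr_pdivrMr// => /ltW /le_trans; apply.
by rewrite ler_pM2r// ler_nat leq_pmull.
Qed.

Section FinePoints.
Context {d : nat} (H r : nat) (D : {set {ffun 'I_d -> 'I_H}}).

(* The fine grid has [4 r] points per cell in each direction and two cubes per
   period; only the first [r] points of a cell are kept, so that the offset of
   two points determines that of their cells up to a quarter of the side. *)
Lemma fine_points : (0 < r)%N ->
  exists2 P : {set {ffun 'I_d -> 'I_(8 * H * r)}}, #|P| = (#|D| * r ^ d)%N &
    forall p, p \in P -> exists2 v, v \in D &
      forall i, (4 * r * v i <= p i < 4 * r * v i + r)%N.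
Proof.
move=> r0.
have lt (v : 'I_H) (u : 'I_r) : (4 * r * v + u < 8 * H * r)%N.
  have := ltn_ord v; have := ltn_ord u; nia.
pose f (vu : {ffun 'I_d -> 'I_H} * {ffun 'I_d -> 'I_r}) : {ffun 'I_d -> 'I_(8 * H * r)} :=
  [ffun i => Ordinal (lt (vu.1 i) (vu.2 i))].
exists [set f vu | vu in finset.setX D [set: {ffun 'I_d -> 'I_r}]%SET]%SET.
  rewrite card_imset.
    by rewrite cardsX cardsT card_ffun !card_ord.
  move=> [v u] [v' u'] /ffunP vu.
  have vui i : (v i = v' i :> nat) /\ (u i = u' i :> nat).
    have := congr1 val (vu i); rewrite !ffunE /=.
    move: (ltn_ord (u i)) (ltn_ord (u' i)).
    move: (nat_of_ord (v i)) (nat_of_ord (v' i)) (nat_of_ord (u i)) (nat_of_ord (u' i)).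
    move=> a b x y xr yr e.
    suff ab : a = b by move: e; rewrite ab => /addnI.
    have lt4 c e' : (c < e' -> 4 * r * c + 4 * r <= 4 * r * e')%N.
      by move=> ce; rewrite -mulnSr leq_mul2l ce orbT.
    by case: (ltngtP a b) => // /lt4; lia.
  by congr pair; apply/ffunP => i; apply: val_inj; have [] := vui i.
move=> p /imsetP[[v u]]; rewrite inE => /andP[/= vD _] ->; exists v => // i.
by rewrite ffunE /= leq_addr ltn_add2l ltn_ord.
Qed.

End FinePoints.

Section Separation.
Context {R : realType} {d : nat}.
Hypothesis d_gt0 : (0 < d)%N.

(** Otherwise every coordinate of the argument is near [0] modulo [2 pi]: the offset of [p] and [q]
    is within a quarter cell of [z], that of their cells within half a cell, and [dense_cells_meet]
    gives two points of [A] differing by [z]. *)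
Lemma separated_bump (A : set 'rV[R]_d) a (l : R) H r (D : {set {ffun 'I_d -> 'I_H}})
    (P : {set {ffun 'I_d -> 'I_(8 * H * r)}}) M z p q :
  lebesgue_measurable A -> 0 < l -> (0 < H)%N -> (0 < r)%N ->
  (forall v, v \in D -> (((1 - (4 * 2 ^+ d)^-1) * (l / H%:R) ^+ d)%:E <=
     lebesgue_outer (A `&` cell a (l / H%:R) H v))%E) ->
  (forall p, p \in P -> exists2 v, v \in D &
      forall i, (4 * r * v i <= p i < 4 * r * v i + r)%N) ->
  (forall x, A x -> ~ A (x - z)) -> (forall i, `|z 0 i| <= l / 2) ->
  p \in P -> q \in P ->
  bump M ((pi / l) *: z - (gridpt (8 * H * r) p - gridpt (8 * H * r) q)) <=
    ((1 + cos (pi / (4 * H%:R))) / 2) ^+ M.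
Proof.
move=> mA l0 H0 r0 DA PD Az zl pP qP.
have [v' v'D pv'] := PD _ pP; have [v vD qv] := PD _ qP.
set w := _ - _; set theta := pi / (4 * H%:R).
have pi0 := pi_gt0 R.
have HR : 1 <= H%:R :> R by rewrite ler1n.
have HR0 : 0 < H%:R :> R by rewrite ltr0n.
have rR : 0 < r%:R :> R by rewrite ltr0n.
have [theta0 thetale] : 0 < theta /\ theta <= pi / 4.
  split; first by rewrite divr_gt0// mulr_gt0.
  by rewrite /theta ler_pM2l// lef_pV2 ?posrE ?mulr_gt0//; lra.
suff [i wi] : exists i, cos (w 0 i) <= cos theta.
  by apply: (bump_le _ _ _ i); lra.
apply: contrapT => /forallNP nw.
pose h := l / H%:R.
have h0 : 0 < h by rewrite divr_gt0.
(* Grid points as points of space measured from [a]; the factor [pi / l] turns the period [2 l] into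
   [2 pi]. *)
pose pos (n : {ffun 'I_d -> 'I_(8 * H * r)}) i : R := h / (4 * r%:R) * (n i)%:R.
have gridE n i : gridpt (8 * H * r) n 0 i = pi / l * pos n i.
  by rewrite !mxE /pos /h !natrM; field; rewrite !gt_eqF.
have posE (n : {ffun 'I_d -> 'I_(8 * H * r)}) (u : {ffun 'I_d -> 'I_H}) i :
    (4 * r * u i <= n i < 4 * r * u i + r)%N ->
    h * (u i)%:R <= pos n i < h * (u i)%:R + h / 4.
  have e : h * (u i)%:R = h / (4 * r%:R) * (4 * r * u i)%:R.
    by rewrite !natrM; field; rewrite gt_eqF.
  have e' : h / 4 = h / (4 * r%:R) * r%:R by field; rewrite gt_eqF.
  have c0 : 0 < h / (4 * r%:R) by rewrite divr_gt0// mulr_gt0.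
  rewrite e e' -mulrDr -natrD /pos ler_pM2l// ltr_pM2l// ler_nat ltr_nat.
  by [].
have posl (n : {ffun 'I_d -> 'I_(8 * H * r)}) (u : {ffun 'I_d -> 'I_H}) i :
    h * (u i)%:R <= pos n i < h * (u i)%:R + h / 4 -> 0 <= pos n i <= l.
  move=> /andP[n1 n2]; have u0 : 0 <= h * (u i)%:R by rewrite mulr_ge0// ltW.
  have : h * (u i).+1%:R <= h * H%:R by rewrite ler_pM2l// ler_nat.
  by rewrite {2}/h divfK ?gt_eqF// -natr1 => ul; apply/andP; split; lra.
have wE i : w 0 i = pi / l * (z 0 i - (pos p i - pos q i)).
  rewrite /w [in LHS]mxE [(pi / l *: z) 0 i]mxE.
  by rewrite [(- _ : 'rV_d) 0 i]mxE [(_ - _ : 'rV_d) 0 i]mxE [(- _ : 'rV_d) 0 i]mxE !gridE; ring.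
have pl0 : 0 < pi / l by rewrite divr_gt0.
have close i : `|z 0 i - (pos p i - pos q i)| < h / 4.
  have hE : h / 4 = theta / (pi / l).
    rewrite /theta /h; move: (pi : R) pi0 => c c0.
    by field; rewrite !gt_eqF.
  rewrite hE ltr_pdivlMr// mulrC -(gtr0_norm pl0) -normrM -wE ltNge.
  apply/negP => thw; apply: (nw i); apply: cos_le_away; first by apply/andP; split; lra.
  rewrite thw/= wE normrM (gtr0_norm pl0).
  have /andP[p1 p2] := posl _ _ _ (posE _ _ _ (pv' i)).
  have /andP[q1 q2] := posl _ _ _ (posE _ _ _ (qv i)).
  (* No wrapping: [|z_i| <= l / 2] and positions differ by at most [l], so [|w_i|] is at most
     [3 pi / 2], below [2 pi - theta]. *)
  apply: (@le_trans _ _ (pi / l * (3 / 2 * l))).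
    rewrite ler_pM2l// ler_norml; have := zl i; rewrite ler_norml => /andP[z1 z2].
    by apply/andP; split; lra.
  rewrite mulrCA divfK ?gt_eqF//.
  lra.
have [|x Ax Axz] := @dense_cells_meet R d d_gt0 A a h H v v' z mA h0 (DA _ vD) (DA _ v'D).
  move=> i; have /andP[p1 p2] := posE _ _ _ (pv' i); have /andP[q1 q2] := posE _ _ _ (qv i).
  have := close i; rewrite ltr_norml => /andP[c1 c2].
  by rewrite ler_norml; apply/andP; split; lra.
exact: (Az x).
Qed.

End Separation.

(** * Sizes of frequencies and lacunary scales *)

Section Frequencies.
Context {R : realType} {d : nat}.
Implicit Types (y xi : 'rV[R]_d) (k : 'rV[int]_d).

Definition norm1 xi : R := \sum_i `|xi 0 i|.

Lemma norm1_ge0 xi : 0 <= norm1 xi.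
Proof. by apply: sumr_ge0 => i _. Qed.

Lemma norm1Z (c : R) xi : 0 <= c -> norm1 (c *: xi) = c * norm1 xi.
Proof.
move=> c0; rewrite /norm1 mulr_sumr; apply: eq_bigr => i _.
by rewrite mxE normrM ger0_norm.
Qed.

Lemma dot_le_norm1 (B : R) y xi : (forall i, `|y 0 i| <= B) -> `|dot y xi| <= B * norm1 xi.
Proof.
move=> yB; rewrite /norm1 mulr_sumr; apply: le_trans (ler_norm_sum _ _ _) _.
by apply: ler_sum => i _; rewrite normrM ler_wpM2r.
Qed.

Lemma norm1_le_euclidean xi : norm1 xi <= d%:R * euclidean_norm xi.
Proof.
rewrite mulr_natl -[X in _ *+ X](card_ord d) -sumr_const; apply: ler_sum => i _.
rewrite -sqrtr_sqr /euclidean_norm ler_wsqrtr// /dot (bigD1 i)//= -expr2 lerDl.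
by apply: sumr_ge0 => j _; rewrite -expr2 sqr_ge0.
Qed.

Lemma freq0 : freq 0 = 0 :> 'rV[R]_d.
Proof. by apply/rowP => i; rewrite !mxE. Qed.

End Frequencies.

(** Greedy choice: each term is taken beyond [lam] times the previous one, and [lam >= 1] extends
    the gap from consecutive indices to all pairs. *)
Lemma lacunary_sequence {R : realType} (Q : R -> Prop) (lam : R) : 1 <= lam ->
  (forall s, exists2 t, s <= t & Q t) ->
  exists t : nat -> R, [/\ forall n, 1 <= t n, forall n, Q (t n) &
    forall i j, (i < j)%N -> lam * t i <= t j].
Proof.
move=> lam1 /(_ (Num.max 1 _)) bad.
have /choice[g gP] s : exists t, Num.max 1 s <= t /\ Q t by have [t] := bad s; exists t.
have g1 s : 1 <= g s by have [] := gP s; rewrite ge_max => /andP[].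
have gs s : s <= g s by have [] := gP s; rewrite ge_max => /andP[].
pose t := fix F n := if n is m.+1 then g (lam * F m) else g 1.
have t1 n : 1 <= t n by case: n => [|n] /=; exact: g1.
exists t; split=> [//|n|i j]; first by case: n => [|n]; exact: (gP _).2.
elim: j => // j IH; rewrite ltnS leq_eqVlt => /orP[/eqP ->|/IH le1].
  exact: gs.
apply: le_trans le1 _; apply: le_trans (gs _).
by rewrite ler_peMl// (le_trans ler01).
Qed.

Theorem theorem1 (R : realType) (d : nat) (hd : (2 <= d)%N) :
  exists2 C : R, 0 < C &
    forall (A : set 'rV[R]_d) (eps : R) (K : set 'rV[R]_d),
      lebesgue_measurable A ->
      0 < eps ->
      upper_density A = eps%:E ->
      symmetric_convex_body K ->
      (exists2 mu : probability (borel R d) R,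
         mu (boundary K) = 1%E & eta_good (C * eps) mu) ->
      exists2 t0 : R, 0 < t0 & forall t : R, t0 <= t -> distance_set K A t.
Proof.
have d_gt0 : (0 < d)%N by apply: leq_trans hd.
(* [gam * eps] bounds below the proportion of the grid occupied by [P]: factors [1 / 2] from
   [dense_cube], [2 ^ -d] from [dense_box], [1 / 2] from [dense_cells], and [8 ^ -d] because [P]
   keeps [H r] of [8 H r] positions per coordinate. *)
pose gam : R := (4 * 16 ^+ d)^-1.
have gam0 : 0 < gam by rewrite invr_gt0 mulr_gt0// exprn_gt0.
exists (gam / 4); first by rewrite divr_gt0.
move=> A eps K mA eps0 Aeps bodyK [mu muK [r r0 good]].
apply: contrapT => no_t0.
have dR0 : (0 : R) < d%:R by rewrite ltr0n.
have pi0 := pi_gt0 R.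
have [B B0 KB] := boundary_bounded K bodyK.
have mK : measurable (boundary K : set (borel R d)).
  apply: measurableD; last by apply: borel_open_measurable; exact: open_interior.
  rewrite -[closure K]setCK; apply: measurableC.
  by apply: borel_open_measurable; rewrite openC; exact: closed_closure.
have [t [t1 tbad tlac]] : exists t : nat -> R, [/\ forall n, 1 <= t n,
    forall n, ~ distance_set K A (t n) &
    forall i j, (i < j)%N -> Num.max 1 (4 * B * (d%:R * r)) * t i <= t j].
  apply: (lacunary_sequence (fun u => ~ distance_set K A u)); first by rewrite le_max lexx.
  move=> s; apply: contrapT => ns; apply: no_t0.
  exists (Num.max 1 s); first by rewrite lt_max ltr01.
  move=> u; rewrite ge_max => /andP[_ su]; apply: contrapT => nu.
  by apply: ns; exists u.
have t0 n : 0 < t n by apply: lt_le_trans (t1 n).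
have sep n x y : boundary K y -> A x -> ~ A (x - t n *: y).
  move=> Ky Ax Ay; apply: (tbad n); exists x => //; exists (x - t n *: y) => //.
  by rewrite opprB addrC subrK (body_norm_boundary K bodyK).
pose eta := gam / 4 * eps.
have eta0 : 0 < eta by rewrite mulr_gt0// divr_gt0.
have ge0 : 0 < gam * eps by rewrite mulr_gt0.
(* With [eta = gam eps / 4] the final inequality reads [J gam eps <= J gam eps / 2 + 2], which this
   [J] refutes. *)
pose J := (Num.truncn (4 / (gam * eps))).+1.
have JP : 4 / (gam * eps) < J%:R by exact: truncnS_gt.
pose beta := eps / 2 / 2 ^+ d.
have beta0 : 0 < beta by rewrite !divr_gt0// exprn_gt0.
(* A side beyond [2 B t_J] keeps the coordinates of [t n *: y] within [l / 2] for all [n < J], as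
   [separated_bump] requires. *)
have [l [lT l0] [a aA]] := dense_box d_gt0 A eps (2 * B * t J) eps0 Aeps.
have tl n y i : (n < J)%N -> boundary K y -> `|(t n *: y) 0 i| <= l / 2.
  move=> nJ Ky; rewrite mxE normrM (gtr0_norm (t0 n)).
  have tJ : t n <= t J.
    by apply: le_trans (tlac _ _ nJ); apply: ler_peMl; [exact: ltW | rewrite le_max lexx].
  have := ler_pM (ltW (t0 n)) (normr_ge0 _) tJ (KB y Ky i); lra.
have kappaP : 0 < (4 * 2 ^+ d)^-1 :> R /\ (4 * 2 ^+ d)^-1 <= 1 :> R.
  have pow1 : 1 <= 2 ^+ d :> R by rewrite exprn_ege1// ler1n.
  split; first by rewrite invr_gt0; lra.
  by rewrite invf_le1; lra.
have [H [H0 [D [Dcard Ddense]]]] := dense_cells d_gt0 a _ l beta _ l0 beta0 (introT andP kappaP)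
  (@subIsetr _ A _) aA.
have HR0 : 0 < H%:R :> R by rewrite ltr0n.
have HR1 : 1 <= H%:R :> R by rewrite ler1n.
have {}Ddense v : v \in D -> (((1 - (4 * 2 ^+ d)^-1) * (l / H%:R) ^+ d)%:E <=
     lebesgue_outer (A `&` cell a (l / H%:R) H v))%E.
  by move=> /Ddense /le_trans; apply; apply: le_lebesgue_outer => x [[Ax _] xv].
pose rho : R := (1 + cos (pi / (4 * H%:R))) / 2.
have [th0 thle] : 0 < pi / (4 * H%:R) :> R /\ pi / (4 * H%:R) <= pi / 4 :> R.
  split; first by rewrite divr_gt0// mulr_gt0.
  by rewrite ler_pM2l// lef_pV2 ?posrE ?mulr_gt0//; lra.
have rhoP : 0 < rho < 1.
  have : 0 < cos (pi / (4 * H%:R)) :> R by apply: cos_gt0_pihalf; apply/andP; split; lra.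
  have : cos (pi / (4 * H%:R)) < 1 :> R.
    by apply: cos_lt1; rewrite gtr0_norm//; apply/andP; split; lra.
  by rewrite /rho => h1 h2; apply/andP; split; lra.
have /andP[rho0 rho1] := rhoP.
have H80 : (0 < 8 * H)%N by rewrite muln_gt0.
have rho20 : 0 < rho / 2 by rewrite divr_gt0.
(* [H], and with it [rho], is fixed before the fineness [rr]. The target carries a factor [rho]
   because the bump has exponent [N - 1]. *)
have [rr rr0 tailP] := poly_geometric rho (rho / 2) (8 * H) d H80 rhoP rho20.
have [P Pcard PD] := @fine_points d H rr D rr0.
set N := (8 * H * rr)%N in P Pcard PD tailP.
have N0 : (0 < N)%N by rewrite muln_gt0 H80.
have {}tailP : N%:R ^+ d * rho ^+ N.-1 <= 1 / 2.
  rewrite -(ler_pM2l rho0) mulrCA -exprS prednK//; lra.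
have [s [phi0 [phi0N s0 phi0E] corr]] := @bump_correlation R d N N0.
have [sumW Wcorr] := corr P.
pose W k := energy (gridpt N) P (freq k) : R.
(* Chosen so that [pi / l * dot (t n *: y) k] equals [2 pi * dot y (tau n *: k)]. *)
pose tau n : R := t n / (2 * l).
have tau0 n : 0 < tau n by rewrite divr_gt0// mulr_gt0.
pose m (j : 'I_J) k := refourier mu (tau j *: freq k).
(* Below this range the phase stays within [pi / 2] on the boundary, so its cosine is nonnegative;
   above it the Euclidean norm is at least [r], where [mu] is good. Inside it only [m j k >= -1] is
   available. *)
pose mid (j : 'I_J) (k : 'rV[int]_d) := (1 < 4 * B * (tau j * norm1 (freq k))) &&
                        (tau j * norm1 (freq k) < d%:R * r).
have mge j k : - eta - (mid j k)%:R <= m j k.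
  have [midjk|] := boolP (mid j k).
    rewrite mulr1n; suff : -1 <= m j k by lra.
    by apply: (refourier_ge mu _ mK muK) => y _; exact: cos_geN1.
  rewrite subr0 negb_and -!leNgt => /orP[low|high].
    apply: (@le_trans _ _ 0); first lra.
    apply: (refourier_ge mu _ mK muK) => y Ky; apply: cos_ge0_pihalf.
    have := dot_le_norm1 B y (tau j *: freq k) (KB y Ky).
    rewrite (norm1Z _ _ (ltW (tau0 j))); set u := dot _ _ => uB.
    rewrite -ler_norml normrM gtr0_norm ?mulr_gt0//.
    have : `|u| <= 1 / 4 by lra.
    by move=> /(ler_wpM2l (ltW pi0)); lra.
  apply: refourier_good; apply: good.
  rewrite -(ler_pM2l dR0); apply: le_trans (norm1_le_euclidean _).
  by rewrite (norm1Z _ _ (ltW (tau0 j))).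
(* If [k] is resonant for an index, then [4 B tau norm1 > 1] there, and the lacunarity ratio
   [4 B d r] pushes [tau norm1] past [d r] for every later index. *)
have midI i j k : mid i k -> mid j k -> i = j.
  have lt_mid (i' j' : 'I_J) : (i' < j')%N -> mid i' k -> mid j' k -> False.
    move=> ij /andP[lo _] /andP[_ hi].
    have n0 := norm1_ge0 (freq k : 'rV[R]_d).
    have tij : 4 * B * (d%:R * r) * tau i' <= tau j'.
      rewrite /tau mulrA ler_pM2r ?invr_gt0 ?mulr_gt0//.
      apply: le_trans (tlac _ _ ij).
      by rewrite ler_pM2r// le_max lexx orbT.
    have := ler_wpM2r n0 tij.
    have dr0 : 0 < d%:R * r by rewrite mulr_gt0.
    move: lo; rewrite -(ltr_pM2l dr0); lra.
  move=> mi mj; apply/val_inj; case: (ltngtP i j) => // ij; exfalso.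
    exact: lt_mid ij mi mj.
  exact: lt_mid ij mj mi.
have mtiny j : \sum_(e <- s) e.1 * W e.2 * m j e.2 <= #|P|%:R ^+ 2 * rho ^+ N.-1.
  apply: (sum_refourier_le mu _ mK muK) => y Ky.
  have -> : \sum_(e <- s) e.1 * W e.2 * phase y (tau j *: freq e.2) =
      \sum_(p in P) \sum_(q in P) bump N.-1 ((pi / l) *: (t j *: y) - (gridpt N p - gridpt N q)).
    rewrite Wcorr; apply: eq_bigr => e _; congr (_ * _).
    rewrite /phase dotZr !dotZl /tau; congr cos.
    rewrite !mulrA; congr (_ * _); rewrite invfM; field.
    by rewrite gt_eqF.
  apply: (@le_trans _ _ (\sum_(p in P) \sum_(q in P) rho ^+ N.-1)).
    apply: ler_sum => p pP; apply: ler_sum => q qP.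
    apply: (@separated_bump _ _ d_gt0 A a l H rr D P) => //.
      by move=> x; exact: sep.
    by move=> i; apply: tl.
  by rewrite !sumr_const -mulrnA -[leLHS]mulr_natl natrM -expr2.
have := lacunary_pigeonhole _ s W m mid eta _ _ (ltW eta0) s0
  (fun k => energy_ge0 _ _ _ _) _ mge midI mtiny sumW.
rewrite card_ord -phi0E /W freq0 energy0.
set p : R := #|P|%:R; set Nd : R := N%:R ^+ d.
have Nd0 : 0 < Nd by rewrite exprn_gt0// ltr0n.
have phi00 : 0 < phi0 by rewrite -(pmulr_lgt0 _ Nd0) (lt_le_trans ltr01 phi0N).
have pge : gam * eps * Nd <= p.
  rewrite /p Pcard natrM natrX.
  have -> : gam * eps * Nd = beta / 2 * H%:R ^+ d * rr%:R ^+ d.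
    rewrite /gam /beta /Nd /N !natrM !exprMn.
    have -> : 16 ^+ d = 8 ^+ d * 2 ^+ d :> R by rewrite -exprMn; congr (_ ^+ d); ring.
    by field; rewrite !expf_neq0.
  by rewrite ler_pM2r// exprn_gt0// ltr0n.
have p0 : 0 < p by apply: lt_le_trans pge; rewrite mulr_gt0.
(* Keeps the separated pairs below half of the frequency [0] term: [N ^ d rho ^ (N - 1) <= 1 / 2 <=
   phi0 N ^ d / 2]. *)
have rho_le : rho ^+ N.-1 <= phi0 / 2.
  rewrite -(ler_pM2l Nd0); apply: le_trans tailP _.
  by move: phi0N; rewrite -/Nd; lra.
move=> /(_ _) main.
have {}main : J%:R * (phi0 * p ^+ 2 / 2) <= (eta * J%:R + 1) * (p * (phi0 * Nd)).
  apply: le_trans (main _); last first.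
    by move=> j; rewrite /m freq0 scaler0; exact: (refourier0 mu _ mK muK).
  rewrite ler_wpM2l//.
  have := ler_wpM2l (sqr_ge0 p) rho_le; lra.
have pphi : 0 < p * phi0 by rewrite mulr_gt0.
have {}main : J%:R * p <= 2 * (eta * J%:R + 1) * Nd.
  by rewrite -(ler_pM2l pphi); move: main; lra.
have : J%:R * (gam * eps) <= 2 * (eta * J%:R + 1).
  rewrite -(ler_pM2r Nd0) -mulrA; apply: le_trans main.
  by rewrite ler_wpM2l.
by move: JP; rewrite ltr_pdivrMr// /eta; lra.
Qed.
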